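(* Let $p>1$, $a\in\mathbb{R}$ with $a\le 1$, and $R\ge 1$. Let $(f,g)\in C_0^2(\mathbb{R})\times C_0^1(\mathbb{R})$ satisfy $\operatorname{supp} f,\ \operatorname{supp} g\subset\{x\in\mathbb{R}:|x|\le R\}$. Assume that $$f(x)\ge 0,\quad g(x)\ge 0\ \text{ for all }x\in\mathbb{R},\quad\text{and}\quad f\not\equiv 0,$$ or $$f(x)\ge 0,\quad g(x)\ge 0\ \text{ for all }x\in\mathbb{R},\quad\text{and}\quad g\not\equiv 0.$$ Then there exist a constant $\varepsilon_1=\varepsilon_1(f,g,p,a,R)>0$ and a constant $C>0$ independent of $\varepsilon$ such that, for every $\varepsilon\in(0,\varepsilon_1]$, the classical solution of the Cauchy problem $$u_{tt}-u_{xx}=\frac{|u_x|^p}{\langle x\rangle^a}\ \text{ in }\mathbb{R}\times(0,T),\qquad u(x,0)=\varepsilon f(x),\quad u_t(x,0)=\varepsilon g(x),\quad x\in\mathbb{R},$$ cannot exist on the time interval $[0,T)$ whenever $$T>\begin{cases} C\varepsilon^{-(p-1)/(1-a)} & \text{if } a<1,\\ \exp\left(C\varepsilon^{-(p-1)}\right) & \text{if } a=1.\end{cases}$$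
   Context: Notation: $\langle x\rangle=(1+x^2)^{1/2}$ for $x\in\mathbb{R}$. $C_0^k(\mathbb{R})$ denotes the $C^k$ functions with compact support. A classical solution on the time interval $[0,T)$ is a real-valued function $u=u(x,t)\in C^2(\mathbb{R}\times[0,T))$ satisfying the equation and the initial conditions pointwise. *)

(* Defs.v *)
From Stdlib Require Import Reals Rtopology.
From Coquelicot Require Import Coquelicot.
Open Scope R_scope.

Definition japanese (x : R) : R := sqrt (1 + x ^ 2).

(* Real power of a nonnegative base, with [0 ^ q = 0] for the exponents [q > 0]
   used here; Stdlib's [Rpower 0 q] is not 0. *)
Definition rpow (x q : R) : R := if Rlt_dec 0 x then Rpower x q else 0.

Definition supp (f : R -> R) : R -> Prop := adherence (fun x => f x <> 0).

Definition Ck (k : nat) (f : R -> R) : Prop :=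
  forall (m : nat) (x : R), (m <= k)%nat ->
    ex_derive_n f m x /\ continuous (Derive_n f m) x.

Definition C0k (k : nat) (f : R -> R) : Prop := Ck k f /\ compact (supp f).

(* Same as [is_derive], with the variable restricted to [D]: at an endpoint of
   an interval [D] this is the one-sided derivative. *)
Definition is_derive_on (D : R -> Prop) (f : R -> R) (x l : R) : Prop :=
  filterdiff f (within D (locally x)) (fun y => scal y l).

Definition time_interval (T t : R) : Prop := 0 <= t < T.

Definition strip (T : R) (z : R * R) : Prop := time_interval T (snd z).

Definition is_partial_x (T : R) (u v : R -> R -> R) : Prop :=
  forall x t, time_interval T t -> is_derive (fun y => u y t) x (v x t).

Definition is_partial_t (T : R) (u v : R -> R -> R) : Prop :=
  forall x t, time_interval T t ->
    is_derive_on (time_interval T) (fun s => u x s) t (v x t).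

(* C^k on R x [0,T), with one-sided time derivatives at t = 0. The values of
   [u x t] for [t] outside [0,T) are irrelevant. *)
Fixpoint Ck_strip (k : nat) (T : R) (u : R -> R -> R) : Prop :=
  continuous_on (strip T) (fun z : R * R => u (fst z) (snd z)) /\
  match k with
  | O => True
  | S k' => exists ux ut : R -> R -> R,
      is_partial_x T u ux /\ is_partial_t T u ut /\
      Ck_strip k' T ux /\ Ck_strip k' T ut
  end.

(* [Derive] and [Derive_n] are total; they are the actual derivatives here since
   [u] is C^2 and the equation is read at interior times. *)
Definition classical_solution (p a : R) (u0 u1 : R -> R) (T : R)
    (u : R -> R -> R) : Prop :=
  Ck_strip 2 T u /\
  (forall x t, 0 < t < T ->
     Derive_n (fun s => u x s) 2 t - Derive_n (fun y => u y t) 2 x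
     = rpow (Rabs (Derive (fun y => u y t) x)) p / Rpower (japanese x) a) /\
  (forall x, u x 0 = u0 x) /\
  (forall x, is_derive_on (time_interval T) (fun t => u x t) 0 (u1 x)).

(* Main.v *)
Require Import Defs.
From Stdlib Require Import Reals Rtopology Lra Lia Classical.
From Coquelicot Require Import Coquelicot.
Open Scope R_scope.

(** The combinations [ut + ux] and [ut - ux] are nondecreasing along the
    characteristics [x + t = const] and [x - t = const], because the source is
    nonnegative.  Hence a solution dominates the free wave with the same data
    ([dalembert_lower]).  By finite speed of propagation it vanishes for
    [|x| >= t + rho] ([flow_vanish]).  The difficulty is that the source controls [ux] only
    through an integral, and that a lower bound for [u] is turned into a lower
    bound for the source only by integrating [ux] from the edge of the support.

    Fix an outgoing characteristic [x = r + t] with [r < rho] on which the free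
    wave stays above a positive multiple of [eps], and let [U] be the solution
    on it.  Integrating [u] along the incoming characteristic from the edge
    [x = t + rho], where it vanishes, and estimating [|ux|] pointwise by
    [lam + lam^(1-p) |ux|^p] gives, after optimizing in [lam],
    [U <= U' (rho - r + B t^a U^(1-p))] ([ray_differential_ineq]).  There is no
    delay in time, since both ends of the estimate use the same incoming
    characteristic.  As long as [U^(p-1)] is below [t^a] this is the ordinary
    inequality [U' >= c t^(-a) U^p] behind the lifespan; afterwards it only
    yields exponential growth.  That second regime is reached by a time [S] of
    order [eps^(-(p-1)/(1-a))], or [exp (C eps^(-(p-1)))] when [a = 1]: for
    [a < 1] the bound [U >= c0 eps] is by itself enough, and for [a = 1] the
    first regime is integrated explicitly ([logarithmic_escape]).

    From [S] to [2 S] the ray value therefore grows by the factor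
    [exp (S / (2 (rho - r)))] ([exponential_growth]).  This is more than any
    power of [S], so a cruder argument that loses powers finishes the proof.
    The mass [M t], the integral of [u] over the support, has [M''] equal to
    the integral of the source, and the same pointwise estimate of [|ux|] gives
    [M'' >= (U / (4 L))^p] and [M'' >= (M / (8 L^2))^p] on an interval of
    half-length [L = 6 S].  The first inequality makes [M] and [M'] large within
    one unit of time; the second lets [M] dominate an explicit function that
    becomes infinite one unit of time later ([no_global_superlinear]).  So the
    ray value at time [2 S] is bounded by a power of [S] ([ray_lt_cap]), and a
    solution cannot live beyond [3 S]. *)

(** * One-sided derivatives and continuity up to the initial time *)

Lemma is_derive_on_locally (D : R -> Prop) (f : R -> R) (x l : R) :
  D x -> is_derive_on D f x l ->
  forall eps : posreal, exists d : posreal, forall y, D y -> Rabs (y - x) < d ->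
    Rabs (f y - f x - (y - x) * l) <= eps * Rabs (y - x).
Proof.
  intros HD [_ H] eps.
  assert (L : is_filter_lim (within D (locally x)) x).
  { intros P HP. unfold within. apply filter_imp with (2 := HP). auto. }
  destruct (H x L eps) as [d Hd].
  exists d. intros y Hy Hyd. exact (Hd y Hyd Hy).
Qed.

Lemma is_derive_on_interior (D : R -> Prop) (f : R -> R) (x l : R) :
  locally x D -> is_derive_on D f x l -> is_derive f x l.
Proof.
  intros HD H.
  pose proof (is_derive_on_locally D f x l (locally_singleton _ _ HD) H) as K.
  apply is_derive_Reals. intros eps Heps.
  destruct (K (mkposreal (eps / 2) ltac:(lra))) as [d Hd].
  destruct HD as [d2 Hd2].
  assert (Hm : 0 < Rmin d d2) by (apply Rmin_pos; [apply d | apply d2]).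
  exists (mkposreal _ Hm). intros h Hh0 Hh. simpl in Hh.
  assert (Hh1 : Rabs h < d) by (eapply Rlt_le_trans; [apply Hh | apply Rmin_l]).
  assert (Hh2 : Rabs h < d2) by (eapply Rlt_le_trans; [apply Hh | apply Rmin_r]).
  specialize (Hd (x + h)). replace (x + h - x) with h in Hd by ring.
  assert (HDh : D (x + h)).
  { apply Hd2. change (Rabs (x + h - x) < d2). replace (x + h - x) with h by ring. exact Hh2. }
  specialize (Hd HDh Hh1). simpl in Hd.
  replace ((f (x + h) - f x) / h - l) with ((f (x + h) - f x - h * l) / h) by (field; exact Hh0).
  unfold Rdiv. rewrite Rabs_mult, Rabs_inv.
  assert (0 < Rabs h) by (apply Rabs_pos_lt; exact Hh0).
  apply Rle_lt_trans with (eps / 2 * Rabs h * / Rabs h).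
  - apply Rmult_le_compat_r; [left; apply Rinv_0_lt_compat; lra | exact Hd].
  - field_simplify; lra.
Qed.

Lemma is_derive_on_unique_left_end (T : R) (f : R -> R) (l1 l2 : R) :
  0 < T -> is_derive_on (time_interval T) f 0 l1 ->
  is_derive_on (time_interval T) f 0 l2 -> l1 = l2.
Proof.
  intros HT H1 H2.
  assert (D0 : time_interval T 0) by (unfold time_interval; lra).
  destruct (Req_dec l1 l2) as [E|E]; [exact E|exfalso].
  assert (He : 0 < Rabs (l1 - l2) / 4).
  { assert (0 < Rabs (l1 - l2)) by (apply Rabs_pos_lt; lra). lra. }
  destruct (is_derive_on_locally _ _ _ _ D0 H1 (mkposreal _ He)) as [d1 K1].
  destruct (is_derive_on_locally _ _ _ _ D0 H2 (mkposreal _ He)) as [d2 K2].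
  set (y := Rmin (T / 2) (Rmin (d1 / 2) (d2 / 2))).
  assert (Hy : 0 < y /\ y <= T / 2 /\ y <= d1 / 2 /\ y <= d2 / 2).
  { pose proof (cond_pos d1). pose proof (cond_pos d2). unfold y, Rmin.
    destruct (Rle_dec (d1/2) (d2/2)); destruct (Rle_dec (T/2) _); lra. }
  pose proof (cond_pos d1). pose proof (cond_pos d2).
  assert (Dy : time_interval T y) by (unfold time_interval; lra).
  specialize (K1 y Dy). specialize (K2 y Dy).
  rewrite Rminus_0_r in *. rewrite (Rabs_pos_eq y) in * by lra.
  specialize (K1 ltac:(lra)). specialize (K2 ltac:(lra)). simpl in K1, K2.
  assert (Rabs (y * (l1 - l2)) <= Rabs (l1 - l2) / 2 * y).
  { replace (y * (l1 - l2)) with ((f y - f 0 - y * l2) - (f y - f 0 - y * l1)) by ring.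
    eapply Rle_trans; [apply Rabs_triang|]. rewrite Rabs_Ropp. lra. }
  rewrite Rabs_mult, (Rabs_pos_eq y) in * by lra. nra.
Qed.

(** Freezing the initial value for [t < 0] turns one-sided continuity at
    [t = 0] into two-sided continuity, so that mean value arguments may start
    at the initial time. *)
Definition time_ext (h : R -> R -> R) (x t : R) : R := h x (Rmax 0 t).

Definition cont_strip (T : R) (h : R -> R -> R) : Prop :=
  forall x t, t < T -> continuity_2d_pt (time_ext h) x t.

(** The slopes [e = 1] and [e = -1] are the two families of characteristics. *)
Definition along (h : R -> R -> R) (c e s : R) : R := time_ext h (c + e * s) s.

Lemma continuous_on_strip (T : R) (h : R -> R -> R) :
  0 < T -> continuous_on (strip T) (fun z : R * R => h (fst z) (snd z)) -> cont_strip T h.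
Proof.
  intros HT H x t Ht eps. unfold time_ext.
  assert (Hm : strip T (x, Rmax 0 t)).
  { unfold strip, time_interval; simpl. unfold Rmax; destruct (Rle_dec 0 t); lra. }
  specialize (H _ Hm (ball (h x (Rmax 0 t)) eps) (locally_ball _ eps)).
  destruct H as [d Hd].
  assert (Hd' : 0 < Rmin d (T - t)) by (apply Rmin_pos; [apply d | lra]).
  exists (mkposreal _ Hd'). simpl. intros v s Hv Hs.
  pose proof (Rmin_l d (T - t)). pose proof (Rmin_r d (T - t)).
  apply (Hd (v, Rmax 0 s)).
  - split; simpl.
    + change (Rabs (v - x) < d). lra.
    + change (Rabs (Rmax 0 s - Rmax 0 t) < d).
      unfold Rabs, Rmax in *.
      destruct (Rcase_abs (s - t)); destruct (Rle_dec 0 s); destruct (Rle_dec 0 t);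
      match goal with |- (if ?b then _ else _) < _ => destruct b end; lra.
  - unfold strip, time_interval; simpl.
    unfold Rabs, Rmax in *. destruct (Rcase_abs (s - t)); destruct (Rle_dec 0 s); lra.
Qed.

Lemma along_continuity (T : R) (h : R -> R -> R) (c e s : R) :
  cont_strip T h -> s < T -> continuity_pt (along h c e) s.
Proof.
  intros H Hs. apply continuity_pt_filterlim. unfold along.
  specialize (H (c + e * s) s Hs). apply continuity_2d_pt_filterlim in H.
  apply (filterlim_comp_2 (F := locally s) (G := locally (c + e * s)) (H := locally s)
     (fun s => c + e * s) (fun s => s) (time_ext h)).
  - apply (ex_derive_continuous (fun s => c + e * s)). auto_derive. exact I.
  - apply filterlim_id.
  - intros P HP. specialize (H P HP). unfold filtermap in *.
    destruct H as [d Hd]. 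
    apply (Filter_prod _ _ _ (ball (c + e * s) d) (ball s d)).
    + apply locally_ball.
    + apply locally_ball.
    + intros y z Hy Hz. apply (Hd (y, z)). split; assumption.
Qed.

Lemma along_pos (h : R -> R -> R) (c e s : R) : 0 <= s -> along h c e s = h (c + e * s) s.
Proof. intros. unfold along, time_ext. rewrite Rmax_right; auto. Qed.

Lemma locally_gt_lt (t lo hi : R) : lo < t < hi -> locally t (fun s => lo < s < hi).
Proof.
  intros H. assert (Hd : 0 < Rmin (t - lo) (hi - t)) by (apply Rmin_pos; lra).
  exists (mkposreal _ Hd). intros y Hy. 
  change (Rabs (y - t) < Rmin (t - lo) (hi - t)) in Hy.
  pose proof (Rmin_l (t - lo) (hi - t)). pose proof (Rmin_r (t - lo) (hi - t)).
  apply Rabs_def2 in Hy. lra.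
Qed.

Lemma cont_strip_interior (T : R) (h : R -> R -> R) (x t : R) :
  cont_strip T h -> 0 < t < T -> continuity_2d_pt h x t.
Proof.
  intros H Ht. apply continuity_2d_pt_ext_loc with (time_ext h); [|apply H; lra].
  exists (mkposreal t (proj1 Ht)). simpl. intros u v _ Hv. apply Rabs_def2 in Hv.
  unfold time_ext. rewrite Rmax_right; lra.
Qed.

(** The chain rule needs [h] to be differentiable in the plane, which follows
    from continuity of one of its two partial derivatives. *)
Lemma along_derive (T : R) (h hx ht : R -> R -> R) (c e t : R) :
  is_partial_x T h hx -> is_partial_t T h ht -> cont_strip T hx -> 0 < t < T ->
  is_derive (along h c e) t (e * hx (c + e * t) t + ht (c + e * t) t).
Proof.
  intros Hx Ht Hc H.
  apply is_derive_ext_loc with (fun s => h (c + e * s) s).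
  { apply filter_imp with (2 := locally_gt_lt t 0 T H). intros y Hy.
    rewrite along_pos; [reflexivity|lra]. }
  assert (FD := is_derive_filterdiff h (c + e * t) t hx (ht (c + e * t) t)).
  assert (FD' : filterdiff (fun u : R * R => h (fst u) (snd u)) (locally (c + e * t, t))
         (fun u : R * R => plus (scal (fst u) (hx (c + e * t) t)) (scal (snd u) (ht (c + e * t) t)))).
  { apply FD.
    - assert (Hl := locally_gt_lt t 0 T H). destruct Hl as [d Hd]. exists d.
      intros [y s] [_ Hs]. simpl in *. apply Hx. specialize (Hd s Hs). unfold time_interval; lra.
    - apply is_derive_on_interior with (time_interval T); [|apply Ht; unfold time_interval; lra].
      apply filter_imp with (2 := locally_gt_lt t 0 T H). unfold time_interval; intros; lra.
    - apply (proj1 (continuity_2d_pt_filterlim hx (c + e * t) t)).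
      apply cont_strip_interior with T; auto. }
  assert (L : filterdiff (fun s : R => c + e * s) (locally t) (fun s : R => e * s)).
  { assert (D : is_derive (fun s => c + e * s) t e) by (auto_derive; [exact I | ring]).
    eapply filterdiff_ext_lin; [exact D|]. intros y. change (y * e = e * y). ring. }
  assert (F2 := filterdiff_comp'_2 (fun s : R => c + e * s) (fun s : R => s) h t
    (fun s => e * s) (fun s => s)
    (fun y s => plus (scal y (hx (c + e * t) t)) (scal s (ht (c + e * t) t)))
    L (filterdiff_id _) FD').
  eapply filterdiff_ext_lin; [exact F2|]. intros y. unfold plus, scal; simpl; unfold mult; simpl. ring.
Qed.

Definition source (p a x z : R) : R := rpow (Rabs z) p / Rpower (japanese x) a.

(** What the argument uses of a classical solution.  The last two fields are
    the factorization of the wave operator into the derivatives along the two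
    families of characteristics, with [e] standing for either direction. *)
Record wave_flow (p a T : R) (u ux ut uxx utt : R -> R -> R) : Prop := {
  flow_u : cont_strip T u;
  flow_ux : cont_strip T ux;
  flow_ut : cont_strip T ut;
  flow_utt : cont_strip T utt;
  flow_dx : forall x t, 0 <= t < T -> is_derive (fun y => u y t) x (ux x t);
  flow_dt : forall x t, 0 < t < T -> is_derive (fun s => u x s) t (ut x t);
  flow_dxx : forall x t, 0 <= t < T -> is_derive (fun y => ux y t) x (uxx x t);
  flow_dtt : forall x t, 0 < t < T -> is_derive (fun s => ut x s) t (utt x t);
  flow_eq : forall x t, 0 < t < T -> utt x t - uxx x t = source p a x (ux x t);
  flow_u_char : forall e c t, e = 1 \/ e = -1 -> 0 < t < T ->
    is_derive (along u c e) t (ut (c + e * t) t + e * ux (c + e * t) t);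
  flow_char : forall e c t, e = 1 \/ e = -1 -> 0 < t < T ->
    is_derive (fun s => along ut c e s - e * along ux c e s) t
      (source p a (c + e * t) (ux (c + e * t) t))
}.

Arguments flow_ux {p a T u ux ut uxx utt}.
Arguments flow_dx {p a T u ux ut uxx utt}.
Arguments flow_dxx {p a T u ux ut uxx utt}.
Arguments flow_eq {p a T u ux ut uxx utt}.
Arguments flow_u_char {p a T u ux ut uxx utt}.
Arguments flow_char {p a T u ux ut uxx utt}.

Lemma is_partial_t_interior (T : R) (h ht : R -> R -> R) (x t : R) :
  is_partial_t T h ht -> 0 < t < T -> is_derive (fun s => h x s) t (ht x t).
Proof.
  intros H Ht. apply is_derive_on_interior with (time_interval T).
  - apply filter_imp with (2 := locally_gt_lt t 0 T Ht). unfold time_interval; intros; lra.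
  - apply H. unfold time_interval; lra.
Qed.

Lemma locally_2d_time (T x t : R) : 0 < t < T ->
  locally_2d (fun _ s => 0 < s < T) x t.
Proof.
  intros Ht. destruct (locally_gt_lt t 0 T Ht) as [d Hd].
  exists d. intros _ s _ Hs. apply Hd. exact Hs.
Qed.

(** The symmetry of second derivatives is what makes the wave operator factor
    along characteristics. *)
Lemma mixed_partials_eq (T : R) (u ux ut uxt utx : R -> R -> R) (x t : R) :
  is_partial_x T u ux -> is_partial_t T u ut ->
  is_partial_t T ux uxt -> is_partial_x T ut utx ->
  cont_strip T uxt -> cont_strip T utx -> 0 < t < T -> uxt x t = utx x t.
Proof.
  intros Hx Ht Hxt Htx Cxt Ctx I.
  assert (Ex : forall y s, 0 < s < T -> Derive (fun z => u z s) y = ux y s).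
  { intros y s Hs. apply is_derive_unique, Hx. unfold time_interval; lra. }
  assert (Et : forall y s, 0 < s < T -> Derive (fun z => u y z) s = ut y s).
  { intros y s Hs. apply is_derive_unique, (is_partial_t_interior T); auto. }
  assert (Dtx : forall y s, 0 < s < T ->
     is_derive (fun z => Derive (fun r => u z r) s) y (utx y s)).
  { intros y s Hs. apply is_derive_ext with (fun z => ut z s).
    - intros z. symmetry. apply Et; auto.
    - apply Htx. unfold time_interval; lra. }
  assert (Dxt : forall y s, 0 < s < T ->
     is_derive (fun z => Derive (fun r => u r z) y) s (uxt y s)).
  { intros y s Hs. apply is_derive_ext_loc with (fun z => ux y z).
    - apply filter_imp with (2 := locally_gt_lt s 0 T Hs). intros z Hz. symmetry. apply Ex; auto.
    - apply (is_partial_t_interior T); auto. }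
  assert (S := Schwarz u x t).
  assert (E1 := is_derive_unique _ _ _ (Dtx x t I)).
  assert (E2 := is_derive_unique _ _ _ (Dxt x t I)).
  transitivity (Derive (fun z : R => Derive (fun r : R => u r z) x) t); [symmetry; exact E2|].
  transitivity (Derive (fun z : R => Derive (fun r : R => u z r) t) x); [symmetry|exact E1].
  apply S.
  - apply locally_2d_impl with (2 := locally_2d_time T x t I).
    apply locally_2d_forall. intros y s Hs. repeat split.
    + exists (ux y s). apply Hx. unfold time_interval; lra.
    + exists (ut y s). apply (is_partial_t_interior T); auto.
    + exists (utx y s); auto.
    + exists (uxt y s); auto.
  - apply continuity_2d_pt_ext_loc with utx; [|apply cont_strip_interior with T; auto].
    apply locally_2d_impl with (2 := locally_2d_time T x t I).
    apply locally_2d_forall. intros y s Hs. symmetry. apply is_derive_unique; auto.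
  - apply continuity_2d_pt_ext_loc with uxt; [|apply cont_strip_interior with T; auto].
    apply locally_2d_impl with (2 := locally_2d_time T x t I).
    apply locally_2d_forall. intros y s Hs. symmetry. apply is_derive_unique; auto.
Qed.

Lemma is_derive_eq (f : R -> R) (x l l' : R) : is_derive f x l -> l = l' -> is_derive f x l'.
Proof. intros H <-. exact H. Qed.

Lemma classical_solution_flow (p a T : R) (u0 u1 : R -> R) (u : R -> R -> R) :
  0 < T -> classical_solution p a u0 u1 T u ->
  exists ux ut uxx utt, wave_flow p a T u ux ut uxx utt /\
    (forall x, u x 0 = u0 x) /\ (forall x, is_derive u0 x (ux x 0)) /\
    (forall x, ut x 0 = u1 x).
Proof.
  intros HT (HC & Heq & H0 & H1).
  destruct HC as (Cu & ux & ut & Hx & Ht & Cx & Ct).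
  destruct Cx as (Cux & uxx & uxt & Hxx & Hxt & Cxx & Cxt).
  destruct Ct as (Cut & utx & utt & Htx & Htt & Ctx & Ctt).
  destruct Cxx as [Cxx _]. destruct Cxt as [Cxt _].
  destruct Ctx as [Ctx _]. destruct Ctt as [Ctt _].
  apply continuous_on_strip in Cu, Cux, Cut, Cxx, Cxt, Ctx, Ctt; try exact HT.
  assert (Hmix : forall x t, 0 < t < T -> uxt x t = utx x t).
  { intros x t I. apply (mixed_partials_eq T u ux ut); auto. }
  assert (Hwave : forall x t, 0 < t < T -> utt x t - uxx x t = source p a x (ux x t)).
  { intros x t I. specialize (Heq x t I). unfold source.
    assert (Ex : forall y, Derive (fun z => u z t) y = ux y t).
    { intros y. apply is_derive_unique, Hx. unfold time_interval; lra. }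
    rewrite Ex in Heq. rewrite <- Heq. f_equal.
    - simpl. symmetry. apply is_derive_unique.
      apply is_derive_ext_loc with (fun s => ut x s); [|apply (is_partial_t_interior T); auto].
      apply filter_imp with (2 := locally_gt_lt t 0 T I). intros s Hs.
      symmetry. apply is_derive_unique. apply (is_partial_t_interior T); auto.
    - simpl. symmetry. apply is_derive_unique.
      apply is_derive_ext with (fun y => ux y t); [|apply Hxx; unfold time_interval; lra].
      intros s. symmetry. apply Ex. }
  exists ux, ut, uxx, utt. split; [|split; [exact H0|split]].
  - constructor; auto.
    + intros x t I. apply (is_partial_t_interior T); auto.
    + intros x t I. apply (is_partial_t_interior T); auto.
    + intros e c t He I. rewrite Rplus_comm. apply (along_derive T); auto.
    + intros e c t He I.
      assert (D1 := along_derive T ut utx utt c e t Htx Htt Ctx I).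
      assert (D2 := along_derive T ux uxx uxt c e t Hxx Hxt Cxx I).
      apply (is_derive_scal _ _ e) in D2.
      eapply is_derive_ext; [|eapply is_derive_eq; [exact (is_derive_minus _ _ _ _ _ D1 D2)|]].
      * reflexivity.
      (* the mixed derivatives cancel and [e * e = 1] *)
      * rewrite <- Hwave, Hmix by auto. unfold minus, plus, opp, scal; simpl; unfold mult; simpl.
        destruct He as [-> | ->]; ring.
  - intros x. apply is_derive_ext with (fun y => u y 0); [exact H0|].
    apply Hx. unfold time_interval; lra.
  - intros x. apply (is_derive_on_unique_left_end T (fun t => u x t)); auto.
    apply Ht. unfold time_interval; lra.
Qed.

(** * Comparison, powers and the size of the nonlinearity *)

(** All integrations along characteristics are done by this comparison of
    increments; no integral of the source has to exist. *)
Lemma increment_le (f g df dg : R -> R) (a b : R) : a <= b ->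
  (forall x, a <= x <= b -> continuity_pt f x) ->
  (forall x, a <= x <= b -> continuity_pt g x) ->
  (forall x, a < x < b -> is_derive f x (df x)) ->
  (forall x, a < x < b -> is_derive g x (dg x)) ->
  (forall x, a < x < b -> df x <= dg x) ->
  f b - f a <= g b - g a.
Proof.
  intros Hab Cf Cg Df Dg Hle.
  destruct (Req_dec a b) as [->|Hne]; [lra|].
  assert (D : forall c, a < c < b -> is_derive (fun x => g x - f x) c (dg c - df c)).
  { intros c Hc. apply (is_derive_minus g f c (dg c) (df c)); auto. }
  assert (pr : forall c, a < c < b -> derivable_pt (fun x => g x - f x) c).
  { intros c Hc. exists (dg c - df c). apply is_derive_Reals. auto. }
  assert (pr2 : forall c, a < c < b -> derivable_pt id c) by (intros; apply derivable_pt_id).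
  destruct (MVT (fun x => g x - f x) id a b pr pr2) as (c & Hc & E); [lra| | |].
  - intros c Hc. apply continuity_pt_minus; auto.
  - intros c Hc. apply derivable_continuous_pt, derivable_pt_id.
  - assert (E1 : derive_pt (fun x => g x - f x) c (pr c Hc) = dg c - df c).
    { apply derive_pt_eq_0. apply is_derive_Reals. auto. }
    assert (E2 : derive_pt id c (pr2 c Hc) = 1).
    { apply derive_pt_eq_0. apply derivable_pt_lim_id. }
    rewrite E1, E2 in E. unfold id in E. specialize (Hle c Hc). nra.
Qed.

Lemma const_continuity_pt (c x : R) : continuity_pt (fun _ => c) x.
Proof. apply continuity_pt_const. intros ? ?; reflexivity. Qed.

Lemma derive_continuity_pt (f : R -> R) (x l : R) : is_derive f x l -> continuity_pt f x.
Proof.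
  intros H. apply derivable_continuous_pt. exists l. apply is_derive_Reals, H.
Qed.

Lemma derive_nonneg_mono (f df : R -> R) (x y : R) : x <= y ->
  (forall z, x <= z <= y -> is_derive f z (df z)) -> (forall z, x <= z <= y -> 0 <= df z) -> f x <= f y.
Proof.
  intros Hxy D P.
  enough (0 - 0 <= f y - f x) by lra.
  apply (increment_le (fun _ => 0) f (fun _ => 0) df x y Hxy).
  - intros z _. apply const_continuity_pt.
  - intros z Hz. apply derive_continuity_pt with (df z). auto.
  - intros z _. apply (is_derive_const 0 z).
  - intros z Hz. apply D. lra.
  - intros z Hz. apply P. lra.
Qed.

Lemma exp_continuity_pt (k c x : R) : continuity_pt (fun s => c * exp (k * s)) x.
Proof.
  apply derivable_continuous_pt. exists (c * (k * exp (k * x))). apply is_derive_Reals.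
  auto_derive; [exact I | ring].
Qed.

(** A walk from the corner [(a, c)] in [n] equal steps, each changing [h] by
    less than 1 by uniform continuity, gives an explicit bound. *)
Lemma bounded_on_box (h : R -> R -> R) (a b c d : R) : a <= b -> c <= d ->
  (forall x y, a <= x <= b -> c <= y <= d -> continuity_2d_pt h x y) ->
  exists M, 0 < M /\ forall x y, a <= x <= b -> c <= y <= d -> Rabs (h x y) <= M.
Proof.
  intros Hab Hcd H.
  destruct (uniform_continuity_2d h a b c d H (mkposreal 1 Rlt_0_1)) as [del Hdel].
  simpl in Hdel. pose proof (cond_pos del) as Hpos.
  destruct (INR_unbounded ((b - a + (d - c)) / del)) as [n Hn].
  exists (Rabs (h a c) + INR n + 1). split.
  { pose proof (Rabs_pos (h a c)). pose proof (pos_INR n). lra. }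
  intros x y Hx Hy.
  assert (Hn0 : 0 < INR n).
  { eapply Rle_lt_trans; [|apply Hn]. apply Rmult_le_pos; [lra|]. left; apply Rinv_0_lt_compat; lra. }
  assert (Hn1 : (b - a) + (d - c) < INR n * del).
  { apply (Rmult_lt_compat_r del) in Hn; [|lra]. unfold Rdiv in Hn.
    rewrite Rmult_assoc, Rinv_l in Hn by lra. lra. }
  set (P := fun i : nat => (a + INR i / INR n * (x - a))).
  set (Q := fun i : nat => (c + INR i / INR n * (y - c))).
  assert (K : forall i, (i <= n)%nat -> 0 <= INR i / INR n <= 1).
  { intros i Hi. apply le_INR in Hi. pose proof (pos_INR i). split.
    - apply Rmult_le_pos; [lra|]. left; apply Rinv_0_lt_compat; lra.
    - apply (Rmult_le_reg_r (INR n)); [lra|]. unfold Rdiv. rewrite Rmult_assoc, Rinv_l by lra. lra. }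
  assert (Ind : forall i, (i <= n)%nat -> Rabs (h (P i) (Q i)) <= Rabs (h a c) + INR i).
  { induction i as [|i IH]; intros Hi.
    - unfold P, Q. simpl. unfold Rdiv. rewrite !Rmult_0_l, !Rplus_0_r. lra.
    - specialize (IH ltac:(lia)).
      assert (K1 := K i ltac:(lia)). assert (K2 := K (S i) Hi).
      assert (step : INR (S i) / INR n = INR i / INR n + / INR n).
      { rewrite S_INR. field. lra. }
      assert (Hin : 0 < / INR n) by (apply Rinv_0_lt_compat; lra).
      assert (Hi3 : / INR n * ((b - a) + (d - c)) < del).
      { apply (Rmult_lt_reg_l (INR n)); [lra|]. rewrite <- Rmult_assoc, Rinv_r by lra. lra. }
      assert (D : Rabs (h (P (S i)) (Q (S i)) - h (P i) (Q i)) < 1).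
      { apply Hdel; unfold P, Q; try (split; nra).
        - rewrite step. match goal with |- Rabs ?e < _ => replace e with (/ INR n * (x - a)) by ring end.
          rewrite Rabs_pos_eq by nra. nra.
        - rewrite step. match goal with |- Rabs ?e < _ => replace e with (/ INR n * (y - c)) by ring end.
          rewrite Rabs_pos_eq by nra. nra. }
      rewrite S_INR.
      replace (h (P (S i)) (Q (S i))) with ((h (P (S i)) (Q (S i)) - h (P i) (Q i)) + h (P i) (Q i)) by ring.
      eapply Rle_trans; [apply Rabs_triang|]. lra. }
  specialize (Ind n (Nat.le_refl n)). unfold P, Q in Ind.
  replace (INR n / INR n) with 1 in Ind by (field; lra).
  replace (a + 1 * (x - a)) with x in Ind by ring.
  replace (c + 1 * (y - c)) with y in Ind by ring. lra.
Qed.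

Lemma japanese_ge_1 (x : R) : 1 <= japanese x.
Proof. unfold japanese. rewrite <- sqrt_1 at 1. apply sqrt_le_1_alt. nra. Qed.

Lemma japanese_le (x : R) : japanese x <= 1 + Rabs x.
Proof.
  unfold japanese. pose proof (Rabs_pos x).
  rewrite <- (sqrt_Rsqr (1 + Rabs x)) by lra. apply sqrt_le_1_alt.
  unfold Rsqr. rewrite <- (pow2_abs x). nra.
Qed.

Lemma japanese_ge_abs (x : R) : Rabs x <= japanese x.
Proof.
  unfold japanese. pose proof (Rabs_pos x).
  rewrite <- (sqrt_Rsqr (Rabs x)) at 1 by lra. apply sqrt_le_1_alt.
  unfold Rsqr. rewrite <- (pow2_abs x). nra.
Qed.

Lemma Rpower_pos (x y : R) : 0 < Rpower x y.
Proof. apply exp_pos. Qed.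

Lemma Rpower_antitone (x y q : R) : 0 < x -> x <= y -> q <= 0 -> Rpower y q <= Rpower x q.
Proof.
  intros Hx Hxy Hq. replace q with (- - q) by ring. rewrite !(Rpower_Ropp _ (- q)).
  apply Rinv_le_contravar; [apply Rpower_pos|]. apply Rle_Rpower_l; lra.
Qed.

Lemma rpow_nonneg (x q : R) : 0 <= rpow x q.
Proof. unfold rpow. destruct (Rlt_dec 0 x); [left; apply Rpower_pos | lra]. Qed.

Lemma source_nonneg (p a x z : R) : 0 <= source p a x z.
Proof.
  unfold source, Rdiv. apply Rmult_le_pos; [apply rpow_nonneg|].
  left. apply Rinv_0_lt_compat, Rpower_pos.
Qed.

(** On a bounded set the source is Lipschitz at [ux = 0], which is what a
    domain of dependence argument needs. *)
Lemma source_le_linear (p a M B x z : R) : 1 < p -> Rabs z <= M -> Rabs x <= B ->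
  source p a x z <= Rpower M (p - 1) * Rpower (1 + B) (Rabs a) * Rabs z.
Proof.
  intros Hp Hz Hx. unfold source, rpow.
  destruct (Rlt_dec 0 (Rabs z)) as [H|H].
  2:{ assert (Rabs z = 0) as -> by (pose proof (Rabs_pos z); lra). unfold Rdiv. lra. }
  unfold Rdiv. rewrite <- Rpower_Ropp.
  replace p with ((p - 1) + 1) at 1 by ring. rewrite Rpower_plus, (Rpower_1 (Rabs z)) by exact H.
  assert (Rpower (Rabs z) (p - 1) <= Rpower M (p - 1)) by (apply Rle_Rpower_l; lra).
  assert (Rpower (japanese x) (- a) <= Rpower (1 + B) (Rabs a)).
  { pose proof (japanese_ge_1 x). pose proof (japanese_le x).
    apply Rle_trans with (Rpower (japanese x) (Rabs a)).
    - apply Rle_Rpower; [lra|]. rewrite <- Rabs_Ropp. apply Rle_abs.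
    - apply Rle_Rpower_l; [apply Rabs_pos | lra]. }
  pose proof (Rpower_pos (Rabs z) (p - 1)). pose proof (Rpower_pos (japanese x) (- a)).
  apply Rle_trans with (Rpower M (p - 1) * Rabs z * Rpower (1 + B) (Rabs a)); [|lra].
  apply Rmult_le_compat; try nra.
Qed.

(** * Growth and blow-up for ordinary differential inequalities *)

Lemma is_derive_Rpower_comp (U : R -> R) (q t v : R) : 0 < U t -> is_derive U t v ->
  is_derive (fun s => Rpower (U s) q) t (q * (v / U t) * Rpower (U t) q).
Proof.
  intros HU D. unfold Rpower. auto_derive.
  - repeat split; [eexists; apply D | exact HU].
  - replace (Derive (fun x => U x) t) with v by (symmetry; apply is_derive_unique, D).
    field. lra.
Qed.

Lemma is_derive_ln_comp (U : R -> R) (t v : R) : 0 < U t -> is_derive U t v ->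
  is_derive (fun s => ln (U s)) t (v / U t).
Proof.
  intros HU D. auto_derive.
  - repeat split; [eexists; apply D | exact HU].
  - replace (Derive (fun x => U x) t) with v by (symmetry; apply is_derive_unique, D).
    field. lra.
Qed.

(** The function [psi] below has derivative at least 1.  The hypothesis on
    [U S] says that its power part can absorb at most half of the increment
    [S], so the logarithm has to take the rest. *)
Lemma exponential_growth (U V : R -> R) (p S Q d : R) : 1 < p -> 0 < S -> 0 < d -> 0 <= Q ->
  (forall t, S <= t <= 2 * S -> 0 < U t) ->
  (forall t, S <= t <= 2 * S -> is_derive U t (V t)) ->
  (forall t, S <= t <= 2 * S -> U t <= V t * (d + Q * Rpower (U t) (1 - p))) ->
  Q / (p - 1) * Rpower (U S) (1 - p) <= S / 2 ->
  U S * exp (S / (2 * d)) <= U (2 * S).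
Proof.
  intros Hp HS Hd HQ HU DU Hineq Hsmall.
  set (psi := fun t => d * ln (U t) - Q / (p - 1) * Rpower (U t) (1 - p)).
  set (dpsi := fun t => d * (V t / U t) - Q / (p - 1) * ((1 - p) * (V t / U t) * Rpower (U t) (1 - p))).
  assert (Dpsi : forall t, S <= t <= 2 * S -> is_derive psi t (dpsi t)).
  { intros t Ht.
    apply (is_derive_minus (fun t => d * ln (U t)) (fun t => Q / (p - 1) * Rpower (U t) (1 - p))).
    - apply (is_derive_scal (fun t => ln (U t)) t d). apply is_derive_ln_comp; auto.
    - apply (is_derive_scal (fun t => Rpower (U t) (1 - p)) t (Q / (p - 1))).
      apply is_derive_Rpower_comp; auto. }
  assert (E : (2 * S - S) <= psi (2 * S) - psi S).
  { apply (increment_le (fun t => t) psi (fun _ => 1) dpsi); try lra.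
    - intros t _. apply derivable_continuous_pt, derivable_pt_id.
    - intros t Ht. eapply derive_continuity_pt. apply Dpsi, Ht.
    - intros t _. apply (is_derive_id t).
    - intros t Ht. apply Dpsi. lra.
    - intros t Ht. specialize (HU t ltac:(lra)). specialize (Hineq t ltac:(lra)).
      unfold dpsi. apply (Rmult_le_reg_l (U t)); [exact HU|].
      replace (U t * (d * (V t / U t) - Q / (p - 1) * ((1 - p) * (V t / U t) * Rpower (U t) (1 - p))))
        with (V t * (d + Q * Rpower (U t) (1 - p))) by (field; lra).
      lra. }
  unfold psi in E.
  pose proof (Rpower_pos (U (2 * S)) (1 - p)) as P2.
  assert (0 <= Q / (p - 1)).
  { apply Rmult_le_pos; [exact HQ | left; apply Rinv_0_lt_compat; lra]. }
  assert (E2 : S / 2 <= d * (ln (U (2 * S)) - ln (U S))) by nra.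
  assert (E3 : S / (2 * d) + ln (U S) <= ln (U (2 * S))).
  { apply (Rmult_le_reg_l d); [exact Hd|].
    replace (d * (S / (2 * d) + ln (U S))) with (S / 2 + d * ln (U S)) by (field; lra). lra. }
  rewrite <- (exp_ln (U S)) at 1 by (apply HU; lra).
  rewrite <- (exp_ln (U (2 * S))) by (apply HU; lra).
  rewrite <- exp_plus. destruct E3 as [E3|E3]; [left; apply exp_increasing; lra | right; f_equal; lra].
Qed.

(** While [U] stays below [c], the constant [d] is at most
    [d c^(p-1) t U^(1-p)], and the inequality becomes that of
    [U' >= const U^p / t], which integrates to a bound on [ln S]. *)
Lemma logarithmic_escape (U V : R -> R) (p s S B d c : R) : 1 < p -> 1 <= s <= S ->
  0 < d -> 0 < B ->
  (forall t, s <= t <= S -> 0 < U t <= c) ->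
  (forall t, s <= t <= S -> 0 <= V t) ->
  (forall t, s <= t <= S -> is_derive U t (V t)) ->
  (forall t, s <= t <= S -> U t <= V t * (d + B * t * Rpower (U t) (1 - p))) ->
  ln S - ln s <= (d * Rpower c (p - 1) + B) / (p - 1) * Rpower (U s) (1 - p).
Proof.
  intros Hp Hs Hd HB HU HV DU Hineq.
  set (E := (d * Rpower c (p - 1) + B) / (p - 1)).
  assert (HE : 0 < E).
  { unfold E. apply Rdiv_lt_0_compat; [|lra]. pose proof (Rpower_pos c (p - 1)). nra. }
  assert (I : ln S - ln s <= - E * Rpower (U S) (1 - p) - - E * Rpower (U s) (1 - p)).
  { apply (increment_le ln (fun t => - E * Rpower (U t) (1 - p)) (fun t => / t)
      (fun t => - E * ((1 - p) * (V t / U t) * Rpower (U t) (1 - p)))); try lra.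
    - intros t Ht. apply derive_continuity_pt with (/ t). apply is_derive_Reals, derivable_pt_lim_ln. lra.
    - intros t Ht. eapply derive_continuity_pt.
      apply (is_derive_scal (fun t => Rpower (U t) (1 - p)) t (- E)).
      apply is_derive_Rpower_comp; [apply HU; lra | apply DU; lra].
    - intros t Ht. apply is_derive_Reals, derivable_pt_lim_ln. lra.
    - intros t Ht. apply (is_derive_scal (fun t => Rpower (U t) (1 - p)) t (- E)).
      apply is_derive_Rpower_comp; [apply HU; lra | apply DU; lra].
    - intros t Ht. specialize (HU t ltac:(lra)). specialize (HV t ltac:(lra)).
      specialize (Hineq t ltac:(lra)).
      set (w := Rpower (U t) (1 - p)) in *.
      assert (Hw : 0 < w) by apply Rpower_pos.
      assert (Hc : 1 <= Rpower c (p - 1) * w).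
      { replace 1 with (Rpower (U t) (p - 1) * w) at 1.
        - apply Rmult_le_compat_r; [lra|]. apply Rle_Rpower_l; lra.
        - unfold w. rewrite <- Rpower_plus. replace (p - 1 + (1 - p)) with 0 by ring.
          apply Rpower_O. lra. }
      apply (Rmult_le_reg_l (U t * t)); [nra|].
      replace (U t * t * / t) with (U t) by (field; lra).
      replace (U t * t * (- E * ((1 - p) * (V t / U t) * w)))
        with (V t * ((d * (Rpower c (p - 1) * w)) * t + B * t * w)) by (unfold E; field; lra).
      eapply Rle_trans; [exact Hineq|]. apply Rmult_le_compat_l; [exact HV|].
      assert (d * 1 <= d * (Rpower c (p - 1) * w)) by (apply Rmult_le_compat_l; lra).
      nra. }
  pose proof (Rpower_pos (U S) (1 - p)). nra.
Qed.

(** The zero is the supremum of the initial interval of positivity. *)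
Lemma first_zero (h : R -> R) (x y : R) : x < y ->
  (forall z, x <= z <= y -> continuity_pt h z) -> 0 < h x -> h y <= 0 ->
  exists c, x < c <= y /\ h c = 0 /\ forall z, x <= z < c -> 0 < h z.
Proof.
  intros Hxy Hc Hx Hy.
  set (E := fun z => x <= z <= y /\ forall w, x <= w <= z -> 0 < h w).
  assert (Ex : E x).
  { split; [lra|]. intros w Hw. replace w with x by lra. exact Hx. }
  destruct (completeness E) as [c [Hub Hlub]].
  { exists y. intros z [Hz _]. lra. }
  { exists x. exact Ex. }
  assert (Hcx : x <= c <= y).
  { split; [apply Hub, Ex | apply Hlub; intros z [Hz _]; lra]. }
  assert (Hbelow : forall z, x <= z < c -> 0 < h z).
  { intros z Hz. destruct (Rlt_dec 0 (h z)) as [P|P]; [exact P|exfalso].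
    enough (c <= z) by lra. apply Hlub. intros w [Hw Hw'].
    destruct (Rle_dec w z) as [L|L]; [exact L|exfalso]. apply P, Hw'. lra. }
  assert (Hnear : h c <> 0 -> exists e, 0 < e /\ forall z, Rabs (z - c) < e -> 0 < h z * h c).
  { intros Hn. assert (HP : 0 < Rabs (h c)) by (apply Rabs_pos_lt; exact Hn).
    destruct (Hc c Hcx (Rabs (h c)) HP) as (e & He & Ke). exists e. split; [exact He|].
    intros z Hz. destruct (Req_dec z c) as [->|Nz]; [nra|].
    assert (K : Rabs (h z - h c) < Rabs (h c)).
    { apply (Ke z). split; [|exact Hz]. split; [exact I | auto]. }
    unfold Rabs in K. destruct (Rcase_abs (h z - h c)); destruct (Rcase_abs (h c)); nra. }
  assert (Hzero : h c = 0).
  { destruct (Req_dec (h c) 0) as [Z|Z]; [exact Z|exfalso].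
    destruct (Hnear Z) as (e & He & Ke).
    destruct (Rlt_dec 0 (h c)) as [P|P].
    - assert (Hcy : c < y) by (destruct (Req_dec c y) as [Q|Q]; [subst; lra | lra]).
      set (w := Rmin y (c + e / 2)).
      assert (Hw : c < w <= y /\ w <= c + e / 2) by (unfold w, Rmin; destruct (Rle_dec y (c + e / 2)); lra).
      enough (w <= c) by lra. apply Hub. split; [lra|].
      intros v Hv. destruct (Rlt_dec v c) as [L|L]; [apply Hbelow; lra|].
      assert (0 < h v * h c) by (apply Ke; rewrite Rabs_pos_eq; lra). nra.
    - assert (Hcx' : x < c) by (destruct (Req_dec c x) as [Q|Q]; [subst; lra | lra]).
      set (w := Rmax x (c - e / 2)).
      assert (Hw : x <= w < c /\ c - e / 2 <= w) by (unfold w, Rmax; destruct (Rle_dec x (c - e / 2)); lra).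
      assert (0 < h w * h c) by (apply Ke; rewrite Rabs_left1; lra).
      assert (0 < h w) by (apply Hbelow; lra). nra. }
  exists c. split; [|split; [exact Hzero | exact Hbelow]].
  destruct (Req_dec c x) as [Q|Q]; [subst; lra | lra].
Qed.

(** The function [D (t0 + 1 - t)^(-m)] with [m = 2 / (p - 1)] satisfies the
    reverse inequality [b'' <= k b^p], starts below [A] with at most its slope, and
    is infinite at [t0 + 1].  Up to a first contact [A''] dominates
    [b''], which keeps [A] strictly above. *)
Lemma no_global_superlinear (p k D t0 : R) (A A1 A2 : R -> R) : 1 < p -> 0 < k -> 0 < D ->
  2 / (p - 1) * (2 / (p - 1) + 1) <= k * Rpower D (p - 1) ->
  (forall t, t0 <= t <= t0 + 1 -> is_derive A t (A1 t)) ->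
  (forall t, t0 <= t <= t0 + 1 -> is_derive A1 t (A2 t)) ->
  (forall t, t0 <= t <= t0 + 1 -> 0 < A t -> k * Rpower (A t) p <= A2 t) ->
  D < A t0 -> 2 / (p - 1) * D <= A1 t0 -> False.
Proof.
  intros Hp Hk HD HkD DA DA1 Hineq H0 H1.
  set (m := 2 / (p - 1)) in *.
  assert (Hm : 0 < m) by (unfold m; apply Rdiv_lt_0_compat; lra).
  assert (Hmp : m * p = m + 2) by (unfold m; field; lra).
  set (b := fun t => D * Rpower (t0 + 1 - t) (- m)).
  set (b1 := fun t => D * m * Rpower (t0 + 1 - t) (- m - 1)).
  set (b2 := fun t => D * m * (m + 1) * Rpower (t0 + 1 - t) (- m - 2)).
  assert (Dpow : forall q t, t < t0 + 1 ->
    is_derive (fun s => Rpower (t0 + 1 - s) q) t (- q * Rpower (t0 + 1 - t) (q - 1))).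
  { intros q t Ht. eapply is_derive_eq.
    - apply (is_derive_Rpower_comp (fun s => t0 + 1 - s) q t (-1)); [lra|].
      auto_derive; [exact I | ring].
    - replace (q - 1) with (q + - (1)) by ring. rewrite Rpower_plus, Rpower_Ropp, Rpower_1 by lra.
      field. lra. }
  assert (Db : forall t, t < t0 + 1 -> is_derive b t (b1 t)).
  { intros t Ht. eapply is_derive_eq; [apply (is_derive_scal _ t D), Dpow, Ht|].
    unfold b1. ring. }
  assert (Db1 : forall t, t < t0 + 1 -> is_derive b1 t (b2 t)).
  { intros t Ht. eapply is_derive_eq; [apply (is_derive_scal _ t (D * m)), Dpow, Ht|].
    unfold b2. replace (- m - 1 - 1) with (- m - 2) by ring. ring. }
  assert (Hb : forall t, t < t0 + 1 -> 0 < b t /\ b2 t <= k * Rpower (b t) p).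
  { intros t Ht. pose proof (Rpower_pos (t0 + 1 - t) (- m)) as P.
    split; [unfold b; nra|]. unfold b, b2.
    rewrite <- Rpower_mult_distr, Rpower_mult by assumption.
    replace (- m * p) with (- m - 2) by lra.
    replace p with ((p - 1) + 1) at 1 by ring. rewrite Rpower_plus, Rpower_1 by exact HD.
    pose proof (Rpower_pos (t0 + 1 - t) (- m - 2)) as P'.
    apply Rle_trans with (D * Rpower (t0 + 1 - t) (- m - 2) * (m * (m + 1))); [lra|].
    apply Rle_trans with (D * Rpower (t0 + 1 - t) (- m - 2) * (k * Rpower D (p - 1))); [|lra].
    apply Rmult_le_compat_l; [nra | exact HkD]. }
  assert (Hb0 : b t0 = D /\ b1 t0 = m * D).
  { unfold b, b1. replace (t0 + 1 - t0) with 1 by ring. unfold Rpower. rewrite ln_1, !Rmult_0_r, exp_0.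
    split; ring. }
  assert (Above : forall t, t0 <= t < t0 + 1 -> b t < A t).
  { intros t Ht. destruct (Rlt_dec (b t) (A t)) as [P|P]; [exact P|exfalso].
    assert (Ht0 : t0 < t).
    { destruct (Req_dec t t0) as [Q|Q]; [|lra]. subst t. lra. }
    destruct (first_zero (fun s => A s - b s) t0 t Ht0) as (c & Hc & Zc & Pc); [|lra|lra|].
    { intros z Hz. apply continuity_pt_minus; eapply derive_continuity_pt; [apply DA | apply Db]; lra. }
    assert (Slope : forall s, t0 <= s <= c -> b1 s <= A1 s).
    { intros s Hs.
      assert (I : b1 s - b1 t0 <= A1 s - A1 t0); [|lra].
      apply (increment_le b1 A1 b2 A2); try lra.
      - intros z Hz. eapply derive_continuity_pt. apply Db1. lra.
      - intros z Hz. eapply derive_continuity_pt. apply DA1. lra.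
      - intros z Hz. apply Db1. lra.
      - intros z Hz. apply DA1. lra.
      - intros z Hz. destruct (Hb z ltac:(lra)) as [Pb Qb]. specialize (Pc z ltac:(lra)).
        apply Rle_trans with (1 := Qb). eapply Rle_trans; [|apply Hineq; lra].
        apply Rmult_le_compat_l; [lra|]. apply Rle_Rpower_l; lra. }
    assert (I : b c - b t0 <= A c - A t0); [|lra].
    apply (increment_le b A b1 A1); try lra.
    - intros z Hz. eapply derive_continuity_pt. apply Db. lra.
    - intros z Hz. eapply derive_continuity_pt. apply DA. lra.
    - intros z Hz. apply Db. lra.
    - intros z Hz. apply DA. lra.
    - intros z Hz. apply Slope. lra. }
  destruct (continuity_ab_maj A t0 (t0 + 1) ltac:(lra)) as (tm & Htm & _).
  { intros z Hz. eapply derive_continuity_pt. apply DA, Hz. }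
  (* at time [t0 + 1 - exp (- y)] the barrier is [D * exp (m * y)], which exceeds
     the maximum [A tm] since [exp z > 1 + z] *)
  set (y := Rabs (A tm) / (D * m) + 1).
  assert (Hy : 0 < y).
  { unfold y. pose proof (Rabs_pos (A tm)).
    assert (0 <= Rabs (A tm) / (D * m)); [|lra].
    apply Rmult_le_pos; [lra|]. left; apply Rinv_0_lt_compat. nra. }
  assert (Hey : 0 < exp (- y) < 1).
  { split; [apply exp_pos|]. rewrite <- exp_0. apply exp_increasing. lra. }
  specialize (Above (t0 + 1 - exp (- y)) ltac:(lra)).
  specialize (Htm (t0 + 1 - exp (- y)) ltac:(lra)).
  unfold b in Above. replace (t0 + 1 - (t0 + 1 - exp (- y))) with (exp (- y)) in Above by ring.
  unfold Rpower in Above. rewrite ln_exp in Above. replace (- m * - y) with (m * y) in Above by ring.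
  assert (Hexp : 1 + m * y < exp (m * y)) by (apply exp_ineq1; nra).
  assert (D * (1 + m * y) = D + D * m + Rabs (A tm)) by (unfold y; field; lra).
  pose proof (Rle_abs (A tm)). nra.
Qed.

(** The choice [lam = X / (2 B)] absorbs half of [X]. *)
Lemma young_optimize (p X B Y : R) : 1 < p -> 0 < X -> 0 < B ->
  (forall lam, 0 < lam -> X <= B * (lam + Rpower lam (1 - p) * Y)) ->
  Rpower (X / (2 * B)) p <= Y.
Proof.
  intros Hp HX HB H. set (z := X / (2 * B)).
  assert (Hz : 0 < z) by (apply Rdiv_lt_0_compat; lra).
  specialize (H z Hz). replace X with (2 * B * z) in H by (unfold z; field; lra).
  pose proof (Rpower_pos z (1 - p)) as P. pose proof (Rpower_pos z (p - 1)) as P'.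
  assert (E : Rpower z (p - 1) * Rpower z (1 - p) = 1).
  { rewrite <- Rpower_plus. replace (p - 1 + (1 - p)) with 0 by ring. apply Rpower_O, Hz. }
  replace p with ((p - 1) + 1) at 1 by ring. rewrite Rpower_plus, Rpower_1 by exact Hz.
  assert (H1 : z <= Rpower z (1 - p) * Y).
  { apply (Rmult_le_reg_l B); lra. }
  apply (Rmult_le_compat_l (Rpower z (p - 1))) in H1; [|lra].
  rewrite <- Rmult_assoc, E in H1. lra.
Qed.

(** Both [ln K] and [N ln S] are eventually below [k S / 2]. *)
Lemma polynomial_le_exponential (K N k : R) : 0 < K -> 0 < k ->
  exists S0, 1 <= S0 /\ forall S, S0 <= S -> K * Rpower S N <= exp (k * S).
Proof.
  intros HK Hk. pose proof (Rabs_pos N) as HN.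
  set (e := k / (2 * (Rabs N + 1))).
  assert (He : 0 < e) by (apply Rdiv_lt_0_compat; lra).
  destruct (proj2 (is_lim_spec _ _ _) is_lim_div_ln_p (mkposreal e He)) as [M HM]. simpl in HM.
  set (S0 := Rmax 1 (Rmax (M + 1) (2 * ln K / k))).
  assert (H0 : 1 <= S0 /\ M + 1 <= S0 /\ 2 * ln K / k <= S0).
  { unfold S0. split; [apply Rmax_l|]. split; (eapply Rle_trans; [|apply Rmax_r]); [apply Rmax_l | apply Rmax_r]. }
  exists S0. split; [lra|]. intros S HS.
  specialize (HM S ltac:(lra)). rewrite Rminus_0_r in HM. apply Rabs_def2 in HM.
  assert (Hln : 0 <= ln S).
  { rewrite <- ln_1. destruct (Req_dec S 1) as [-> | Q]; [lra|]. left. apply ln_increasing; lra. }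
  assert (HlnS : ln S <= e * S).
  { replace (ln S) with (ln S / S * S) by (field; lra). apply Rmult_le_compat_r; lra. }
  assert (H1 : N * ln S <= k / 2 * S).
  { apply Rle_trans with ((Rabs N + 1) * (e * S)).
    - pose proof (Rle_abs N). apply Rle_trans with ((Rabs N + 1) * ln S); nra.
    - right. unfold e. field. lra. }
  assert (H2 : ln K <= k / 2 * S).
  { apply Rle_trans with (k / 2 * (2 * ln K / k)); [right; field; lra|]. apply Rmult_le_compat_l; lra. }
  rewrite <- (exp_ln K) at 1 by exact HK. unfold Rpower. rewrite <- exp_plus.
  destruct (Req_dec (ln K + N * ln S) (k * S)) as [-> | Q]; [lra|]. left. apply exp_increasing. lra.
Qed.

(** * Characteristics and finite speed of propagation *)

Section Flow.
Context {p a T : R} {u ux ut uxx utt : R -> R -> R}.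
Context (W : wave_flow p a T u ux ut uxx utt).

Lemma flow_char_continuity (e c s : R) : s < T ->
  continuity_pt (fun s => along ut c e s - e * along ux c e s) s.
Proof.
  intros Hs. apply continuity_pt_minus; [|apply continuity_pt_scal];
  apply along_continuity with T; auto; apply W.
Qed.

Lemma flow_char_ge (g dg : R -> R) (e c s t : R) : e = 1 \/ e = -1 -> 0 <= s <= t -> t < T ->
  (forall r, s <= r <= t -> continuity_pt g r) ->
  (forall r, s < r < t -> is_derive g r (dg r)) ->
  (forall r, s < r < t -> dg r <= source p a (c + e * r) (ux (c + e * r) r)) ->
  g t - g s <= (ut (c + e * t) t - e * ux (c + e * t) t) - (ut (c + e * s) s - e * ux (c + e * s) s).
Proof.
  intros He Hs Ht Cg Dg Hle.
  rewrite <- (along_pos ut c e t), <- (along_pos ux c e t), <- (along_pos ut c e s), <- (along_pos ux c e s) by lra.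
  apply (increment_le g (fun s => along ut c e s - e * along ux c e s) dg
    (fun r => source p a (c + e * r) (ux (c + e * r) r)) s t); auto; try lra.
  - intros r Hr. apply flow_char_continuity. lra.
  - intros r Hr. apply (flow_char W); auto. lra.
Qed.

Lemma flow_char_le (g dg : R -> R) (e c s t : R) : e = 1 \/ e = -1 -> 0 <= s <= t -> t < T ->
  (forall r, s <= r <= t -> continuity_pt g r) ->
  (forall r, s < r < t -> is_derive g r (dg r)) ->
  (forall r, s < r < t -> source p a (c + e * r) (ux (c + e * r) r) <= dg r) ->
  (ut (c + e * t) t - e * ux (c + e * t) t) - (ut (c + e * s) s - e * ux (c + e * s) s) <= g t - g s.
Proof.
  intros He Hs Ht Cg Dg Hle.
  rewrite <- (along_pos ut c e t), <- (along_pos ux c e t), <- (along_pos ut c e s), <- (along_pos ux c e s) by lra.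
  apply (increment_le (fun s => along ut c e s - e * along ux c e s) g
    (fun r => source p a (c + e * r) (ux (c + e * r) r)) dg s t); auto; try lra.
  - intros r Hr. apply flow_char_continuity. lra.
  - intros r Hr. apply (flow_char W); auto. lra.
Qed.

Lemma flow_char_mono (e c s t : R) : e = 1 \/ e = -1 -> 0 <= s <= t -> t < T ->
  ut (c + e * s) s - e * ux (c + e * s) s <= ut (c + e * t) t - e * ux (c + e * t) t.
Proof.
  intros He Hs Ht.
  assert (H := flow_char_ge (fun _ => 0) (fun _ => 0) e c s t He Hs Ht).
  enough (0 - 0 <= ut (c + e * t) t - e * ux (c + e * t) t - (ut (c + e * s) s - e * ux (c + e * s) s)) by lra.
  apply H.
  - intros r _. apply const_continuity_pt.
  - intros r _. apply (is_derive_const 0 r).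
  - intros r _. apply source_nonneg.
Qed.

Lemma flow_u_ge (g dg : R -> R) (e c s t : R) : e = 1 \/ e = -1 -> 0 <= s <= t -> t < T ->
  (forall r, s <= r <= t -> continuity_pt g r) ->
  (forall r, s < r < t -> is_derive g r (dg r)) ->
  (forall r, s < r < t -> dg r <= ut (c + e * r) r + e * ux (c + e * r) r) ->
  g t - g s <= u (c + e * t) t - u (c + e * s) s.
Proof.
  intros He Hs Ht Cg Dg Hle. rewrite <- (along_pos u c e t), <- (along_pos u c e s) by lra.
  apply (increment_le g (along u c e) dg (fun r => ut (c + e * r) r + e * ux (c + e * r) r) s t);
    auto; try lra.
  - intros r Hr. apply along_continuity with T; [apply W | lra].
  - intros r Hr. apply (flow_u_char W); auto. lra.
Qed.

Lemma flow_u_le (g dg : R -> R) (e c s t : R) : e = 1 \/ e = -1 -> 0 <= s <= t -> t < T ->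
  (forall r, s <= r <= t -> continuity_pt g r) ->
  (forall r, s < r < t -> is_derive g r (dg r)) ->
  (forall r, s < r < t -> ut (c + e * r) r + e * ux (c + e * r) r <= dg r) ->
  u (c + e * t) t - u (c + e * s) s <= g t - g s.
Proof.
  intros He Hs Ht Cg Dg Hle. rewrite <- (along_pos u c e t), <- (along_pos u c e s) by lra.
  apply (increment_le (along u c e) g (fun r => ut (c + e * r) r + e * ux (c + e * r) r) dg s t);
    auto; try lra.
  - intros r Hr. apply along_continuity with T; [apply W | lra].
  - intros r Hr. apply (flow_u_char W); auto. lra.
Qed.

(** Finite speed of propagation.  On the backward triangle the source is at
    most [K |ux|], so a bound [B exp (2 K s)] for [|ux|], integrated along both
    families of characteristics from zero data, improves to half of itself;
    iterating, [ux] vanishes there, then [ut] and [u]. *)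
Lemma flow_vanish (x0 t0 : R) : 1 < p -> 0 <= t0 < T ->
  (forall y, x0 - t0 <= y <= x0 + t0 -> u y 0 = 0 /\ ux y 0 = 0 /\ ut y 0 = 0) ->
  u x0 t0 = 0.
Proof.
  intros Hp Ht H0.
  set (tri := fun y s => 0 <= s <= t0 /\ x0 - (t0 - s) <= y <= x0 + (t0 - s)).
  destruct (bounded_on_box (time_ext ux) (x0 - t0) (x0 + t0) 0 t0) as (M & HM & Mb); try lra.
  { intros x y _ Hy. apply (flow_ux W). lra. }
  assert (Hux : forall y s, tri y s -> Rabs (ux y s) <= M).
  { intros y s (Hs & Hy). specialize (Mb y s ltac:(lra) ltac:(lra)).
    unfold time_ext in Mb. rewrite Rmax_right in Mb by lra. exact Mb. }
  set (K := Rpower M (p - 1) * Rpower (1 + (Rabs x0 + t0)) (Rabs a)).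
  assert (HK : 0 < K) by (apply Rmult_lt_0_compat; apply Rpower_pos).
  assert (Hsrc : forall y s, tri y s -> source p a y (ux y s) <= K * Rabs (ux y s)).
  { intros y s Hys. apply source_le_linear; auto. destruct Hys as (Hs & Hy).
    unfold Rabs; destruct (Rcase_abs y); destruct (Rcase_abs x0); lra. }
  assert (Htri : forall e y s r, e = 1 \/ e = -1 -> tri y s -> 0 <= r <= s -> tri (y - e * s + e * r) r).
  { intros e y s r He (Hs & Hy) Hr. unfold tri. destruct He as [-> | ->]; lra. }
  assert (Hzero : forall y, tri y 0 -> ux y 0 = 0 /\ ut y 0 = 0).
  { intros y (_ & Hy). apply H0. lra. }
  (* the growth rate 2K beats the rate K of the source, which gains a factor 2 *)
  assert (Half : forall B, 0 <= B ->
    (forall y s, tri y s -> Rabs (ux y s) <= B * exp (2 * K * s)) ->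
    forall e y s, e = 1 \/ e = -1 -> tri y s ->
      0 <= ut y s - e * ux y s <= B / 2 * exp (2 * K * s)).
  { intros B HB HBb e y s He Hys. pose proof (proj1 Hys).
    assert (Hz : ux (y - e * s + e * 0) 0 = 0 /\ ut (y - e * s + e * 0) 0 = 0).
    { apply Hzero. apply Htri with (1 := He) (2 := Hys). lra. }
    split.
    - assert (Q := flow_char_mono e (y - e * s) 0 s He ltac:(lra) ltac:(lra)).
      replace (y - e * s + e * s) with y in Q by ring.
      destruct Hz as [Z1 Z2]. rewrite Z1, Z2 in Q. lra.
    - assert (Q := flow_char_le (fun r => B / 2 * exp (2 * K * r)) (fun r => K * (B * exp (2 * K * r)))
        e (y - e * s) 0 s He ltac:(lra) ltac:(lra)).
      replace (y - e * s + e * s) with y in Q by ring.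
      cbv beta in Q. destruct Hz as [Z1 Z2]. rewrite Z1, Z2 in Q.
      replace (2 * K * 0) with 0 in Q by ring. rewrite exp_0 in Q.
      assert (ut y s - e * ux y s - (0 - e * 0) <= B / 2 * exp (2 * K * s) - B / 2 * 1); [|lra].
      apply Q.
      + intros r _. apply exp_continuity_pt.
      + intros r _. auto_derive; [exact I | field].
      + intros r Hr. assert (Tr := Htri e y s r He Hys ltac:(lra)).
        eapply Rle_trans; [apply Hsrc, Tr|]. apply Rmult_le_compat_l; [lra|]. apply HBb, Tr. }
  assert (Decay : forall n y s, tri y s -> Rabs (ux y s) <= M * (/ 2) ^ n * exp (2 * K * s)).
  { induction n as [|n IH]; intros y s Hys.
    - simpl. eapply Rle_trans; [apply Hux, Hys|].
      assert (1 <= exp (2 * K * s)).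
      { rewrite <- exp_0. destruct Hys as [[Hs _] _]. assert (0 <= 2 * K * s) by nra.
        destruct (Req_dec 0 (2 * K * s)) as [<-|N]; [lra|]. left. apply exp_increasing. lra. }
      nra.
    - assert (HB : 0 <= M * (/ 2) ^ n) by (apply Rmult_le_pos; [lra | apply pow_le; lra]).
      assert (P1 := Half _ HB IH 1 y s (or_introl eq_refl) Hys).
      assert (P2 := Half _ HB IH (-1) y s (or_intror eq_refl) Hys).
      simpl. apply Rabs_le. lra. }
  assert (Z : forall y s, tri y s -> ux y s = 0).
  { intros y s Hys. destruct (Req_dec (ux y s) 0) as [E|E]; [exact E|exfalso].
    apply Rabs_pos_lt in E. pose proof (exp_pos (2 * K * s)) as He.
    assert (Hc : 0 < M * exp (2 * K * s)) by nra.
    destruct (pow_lt_1_zero (/ 2) ltac:(rewrite Rabs_pos_eq; lra) (Rabs (ux y s) / (M * exp (2 * K * s)))) as [n Hn].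
    { apply Rmult_lt_0_compat; [lra | apply Rinv_0_lt_compat; lra]. }
    specialize (Hn n (Nat.le_refl n)). specialize (Decay n y s Hys).
    rewrite Rabs_pos_eq in Hn by (apply pow_le; lra).
    apply (Rmult_lt_compat_r (M * exp (2 * K * s))) in Hn; [|exact Hc].
    replace (Rabs (ux y s) / (M * exp (2 * K * s)) * (M * exp (2 * K * s))) with (Rabs (ux y s)) in Hn
      by (field; split; lra).
    nra. }
  assert (Zt : forall y s, tri y s -> ut y s = 0).
  { intros y s Hys.
    assert (Q := Half 0 ltac:(lra)). 
    assert (Q' : forall y s, tri y s -> Rabs (ux y s) <= 0 * exp (2 * K * s)).
    { intros y' s' H'. rewrite Z, Rabs_R0 by exact H'. lra. }
    specialize (Q Q' 1 y s (or_introl eq_refl) Hys). rewrite (Z y s Hys) in Q. lra. }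
  assert (T0 : tri x0 t0) by (unfold tri; lra).
  assert (Hd : forall r, 0 < r < t0 ->
    ut (x0 - t0 + 1 * r) r + 1 * ux (x0 - t0 + 1 * r) r = 0).
  { intros r Hr. assert (Tr := Htri 1 x0 t0 r (or_introl eq_refl) T0 ltac:(lra)).
    rewrite Rmult_1_l in Tr at 1. rewrite (Z _ _ Tr), (Zt _ _ Tr). lra. }
  assert (U1 := flow_u_ge (fun _ => 0) (fun _ => 0) 1 (x0 - t0) 0 t0 (or_introl eq_refl) ltac:(lra) ltac:(lra)
    ltac:(intros; apply const_continuity_pt) ltac:(intros r _; apply (is_derive_const 0 r))
    ltac:(intros r Hr; rewrite Hd; lra)).
  assert (U2 := flow_u_le (fun _ => 0) (fun _ => 0) 1 (x0 - t0) 0 t0 (or_introl eq_refl) ltac:(lra) ltac:(lra)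
    ltac:(intros; apply const_continuity_pt) ltac:(intros r _; apply (is_derive_const 0 r))
    ltac:(intros r Hr; rewrite Hd; lra)).
  cbv beta in U1, U2.
  replace (x0 - t0 + 1 * t0) with x0 in U1, U2 by ring.
  destruct (H0 (x0 - t0 + 1 * 0)) as [E _]; [lra|]. rewrite E in U1, U2. lra.
Qed.
End Flow.

(** * The solution along an outgoing characteristic *)

(** The pointwise substitute for Hoelder's inequality: either [|z| <= lam], or
    [|z| <= lam^(1-p) |z|^p]. *)
Lemma abs_le_source (p a x z lam K : R) : 1 < p -> 0 < lam -> Rpower (japanese x) a <= K ->
  Rabs z <= lam + Rpower lam (1 - p) * K * source p a x z.
Proof.
  intros Hp Hl HK. pose proof (Rpower_pos (japanese x) a) as HJ.
  assert (HS : rpow (Rabs z) p <= K * source p a x z).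
  { replace (rpow (Rabs z) p) with (Rpower (japanese x) a * source p a x z) by (unfold source; field; lra).
    apply Rmult_le_compat_r; [apply source_nonneg | exact HK]. }
  pose proof (Rpower_pos lam (1 - p)) as Hlp.
  pose proof (rpow_nonneg (Rabs z) p) as Hr.
  destruct (Rle_dec (Rabs z) lam) as [Hz|Hz]; [nra|].
  assert (Rabs z <= Rpower lam (1 - p) * rpow (Rabs z) p); [|nra].
  unfold rpow. destruct (Rlt_dec 0 (Rabs z)) as [H|H]; [|lra].
  replace p with ((p - 1) + 1) at 2 by ring. rewrite Rpower_plus, Rpower_1 by exact H.
  assert (1 <= Rpower lam (1 - p) * Rpower (Rabs z) (p - 1)); [|nra].
  replace 1 with (Rpower lam (1 - p) * Rpower lam (p - 1)) at 1.
  - apply Rmult_le_compat_l; [lra|]. apply Rle_Rpower_l; lra.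
  - rewrite <- Rpower_plus. replace (1 - p + (p - 1)) with 0 by ring. apply Rpower_O; exact Hl.
Qed.

Lemma Rpower_comparable (k S y a : R) : 1 <= k -> 0 < S -> S / k <= y <= k * S ->
  Rpower y a <= Rpower k (Rabs a) * Rpower S a.
Proof.
  intros Hk HS [H1 H2].
  assert (HSk : 0 < S / k) by (apply Rdiv_lt_0_compat; lra).
  assert (Hy : 0 < y) by lra.
  unfold Rpower. rewrite <- exp_plus.
  assert (L1 : ln y <= ln k + ln S).
  { rewrite <- ln_mult by lra. destruct H2 as [H2| ->]; [left; apply ln_increasing; lra | lra]. }
  assert (L2 : ln S - ln k <= ln y).
  { rewrite <- ln_div by lra. destruct H1 as [H1| <-]; [left; apply ln_increasing; lra | lra]. }
  assert (L : a * ln y <= Rabs a * ln k + a * ln S).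
  { unfold Rabs. destruct (Rcase_abs a); nra. }
  destruct L as [L|L]; [left; apply exp_increasing, L | rewrite L; lra].
Qed.

(** [G] is a primitive of [g].  The number [r] labels an outgoing
    characteristic [x = r + t], and [c0] is a lower bound for the free wave on
    it once [t >= rho], by d'Alembert's formula. *)
Record bump_data (rho r c0 : R) (f df g G : R -> R) : Prop := {
  data_rho : 1 <= rho;
  data_r : - rho <= r < rho;
  data_f : forall x, 0 <= f x;
  data_g : forall x, 0 <= g x;
  data_df : forall x, is_derive f x (df x);
  data_G : forall x, is_derive G x (g x);
  data_out : forall x, rho <= Rabs x -> f x = 0 /\ df x = 0 /\ g x = 0;
  data_c0 : 0 < c0 <= (f r + (G rho - G r)) / 2
}.

Arguments data_rho {rho r c0 f df g G}.
Arguments data_r {rho r c0 f df g G}.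
Arguments data_f {rho r c0 f df g G}.
Arguments data_g {rho r c0 f df g G}.
Arguments data_df {rho r c0 f df g G}.
Arguments data_G {rho r c0 f df g G}.
Arguments data_out {rho r c0 f df g G}.
Arguments data_c0 {rho r c0 f df g G}.

Section Bump.
Context (p a T : R) (u ux ut uxx utt : R -> R -> R).
Context (W : wave_flow p a T u ux ut uxx utt).
Context (rho r c0 : R) (f df g G : R -> R) (D : bump_data rho r c0 f df g G).
Context (eps : R).
Context (Hp : 1 < p) (Ha : a <= 1) (Heps : 0 < eps).
Context (I0 : forall x, u x 0 = eps * f x) (I1 : forall x, ux x 0 = eps * df x)
  (I2 : forall x, ut x 0 = eps * g x).

Lemma flow_char_data (e x t : R) : e = 1 \/ e = -1 -> 0 <= t < T ->
  eps * (g (x - e * t) - e * df (x - e * t)) <= ut x t - e * ux x t.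
Proof.
  intros He Ht.
  assert (Q := flow_char_mono W e (x - e * t) 0 t He ltac:(lra) ltac:(lra)).
  replace (x - e * t + e * t) with x in Q by ring.
  replace (x - e * t + e * 0) with (x - e * t) in Q by ring.
  rewrite I1, I2 in Q. lra.
Qed.

(** The derivative of [u] along the outgoing characteristic is [ut + ux],
    which is at least its value at the foot of the incoming one. *)
Lemma dalembert_lower (x t : R) : 0 <= t < T ->
  eps / 2 * (f (x + t) + f (x - t) + (G (x + t) - G (x - t))) <= u x t.
Proof.
  intros Ht.
  assert (Q := flow_u_ge W
    (fun s => eps / 2 * (f (x - t + 2 * s) + G (x - t + 2 * s)))
    (fun s => eps * (g (x - t + 2 * s) + df (x - t + 2 * s)))
    1 (x - t) 0 t (or_introl eq_refl) ltac:(lra) ltac:(lra)).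
  assert (Dd : forall s, is_derive (fun s => eps / 2 * (f (x - t + 2 * s) + G (x - t + 2 * s))) s
      (eps * (g (x - t + 2 * s) + df (x - t + 2 * s)))).
  { intros s. pose proof (data_df D (x - t + 2 * s)) as H1.
    pose proof (data_G D (x - t + 2 * s)) as H2.
    auto_derive.
    - repeat split; [eexists; apply H1 | eexists; apply H2].
    - replace (Derive (fun x0 => f x0) (x - t + 2 * s)) with (df (x - t + 2 * s)) by (symmetry; apply is_derive_unique, H1).
      replace (Derive (fun x0 => G x0) (x - t + 2 * s)) with (g (x - t + 2 * s)) by (symmetry; apply is_derive_unique, H2).
      field. }
  cbv beta in Q.
  replace (x - t + 1 * t) with x in Q by ring.
  replace (x - t + 1 * 0) with (x - t) in Q by ring.
  replace (x - t + 2 * t) with (x + t) in Q by ring.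
  replace (x - t + 2 * 0) with (x - t) in Q by ring.
  rewrite I0 in Q.
  enough (eps / 2 * (f (x + t) + G (x + t)) - eps / 2 * (f (x - t) + G (x - t)) <= u x t - eps * f (x - t)) by lra.
  apply Q.
  - intros s _. eapply derive_continuity_pt. apply Dd.
  - intros s _. apply Dd.
  - intros s Hs.
    assert (P := flow_char_data (-1) (x - t + 1 * s) s (or_intror eq_refl) ltac:(lra)).
    replace (x - t + 1 * s - -1 * s) with (x - t + 2 * s) in P by ring. lra.
Qed.

Lemma primitive_mono (x y : R) : x <= y -> G x <= G y.
Proof.
  intros H. apply (derive_nonneg_mono G g x y H); intros z _; apply D.
Qed.

Lemma flow_nonneg (x t : R) : 0 <= t < T -> 0 <= u x t.
Proof.
  intros Ht. eapply Rle_trans; [|apply dalembert_lower, Ht].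
  pose proof (data_f D (x + t)). pose proof (data_f D (x - t)).
  pose proof (primitive_mono (x - t) (x + t) ltac:(lra)).
  apply Rmult_le_pos; lra.
Qed.

Lemma flow_outside (x t : R) : 0 <= t < T -> t + rho <= Rabs x -> u x t = 0.
Proof.
  intros Ht Hx. apply (flow_vanish W); auto.
  intros y Hy.
  destruct (data_out D y) as (E1 & E2 & E3).
  - unfold Rabs in *. destruct (Rcase_abs x); destruct (Rcase_abs y); lra.
  - rewrite I0, I1, I2, E1, E2, E3. repeat split; ring.
Qed.

(** The factor 1 is the direction [e = 1] of [along]. *)
Definition ray (t : R) : R := u (r + 1 * t) t.
Definition ray_speed (t : R) : R := ut (r + 1 * t) t + 1 * ux (r + 1 * t) t.

Lemma ray_derive (t : R) : 0 < t < T -> is_derive ray t (ray_speed t).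
Proof.
  intros Ht. apply is_derive_ext_loc with (along u r 1).
  - apply filter_imp with (2 := locally_gt_lt t 0 T Ht). intros s Hs. apply along_pos. lra.
  - apply (flow_u_char W); auto.
Qed.

Lemma ray_speed_nonneg (t : R) : rho <= t < T -> 0 <= ray_speed t.
Proof.
  intros Ht. pose proof (data_rho D). pose proof (data_r D).
  assert (P := flow_char_data (-1) (r + 1 * t) t (or_intror eq_refl) ltac:(lra)).
  destruct (data_out D (r + 1 * t - -1 * t)) as (_ & E2 & E3).
  { rewrite Rabs_pos_eq; lra. }
  rewrite E2, E3 in P. unfold ray_speed. lra.
Qed.

Lemma ray_lower (t : R) : rho <= t < T -> eps * c0 <= ray t.
Proof.
  intros Ht. pose proof (data_rho D). pose proof (data_r D).
  eapply Rle_trans; [|apply dalembert_lower; lra].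
  replace (r + 1 * t - t) with r by ring.
  pose proof (data_f D (r + 1 * t + t)).
  pose proof (primitive_mono rho (r + 1 * t + t) ltac:(lra)).
  pose proof (data_c0 D).
  apply Rle_trans with (eps * ((f r + (G rho - G r)) / 2)).
  - apply Rmult_le_compat_l; lra.
  - apply Rle_trans with (eps / 2 * (f r + (G rho - G r))); [lra|].
    apply Rmult_le_compat_l; lra.
Qed.

Lemma ray_pos (t : R) : rho <= t < T -> 0 < ray t.
Proof.
  intros Ht. pose proof (data_c0 D).
  eapply Rlt_le_trans; [|apply ray_lower, Ht]. apply Rmult_lt_0_compat; lra.
Qed.

Lemma ray_mono (s t : R) : rho <= s <= t -> t < T -> ray s <= ray t.
Proof.
  intros Hs Ht. pose proof (data_rho D).
  apply (derive_nonneg_mono ray ray_speed s t); [lra| |]; intros z Hz.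
  - apply ray_derive. lra.
  - apply ray_speed_nonneg. lra.
Qed.

(** The time that an incoming characteristic takes from the edge of the support
    to the ray. *)
Let d := (rho - r) / 2.

(** Go back from the ray along the incoming characteristic until it leaves the
    support, where [u = 0].  On it the derivative of [u] is
    [(ut + ux) - 2 ux]; the first term is at most its final value, the ray
    speed, and [|ux|] is at most [lam] plus a multiple of the source, which is
    exactly the derivative of [ut + ux]. *)
Lemma ray_le_young (t lam K : R) : rho <= t < T -> 0 < lam ->
  (forall x, r + t <= x <= rho + t -> Rpower (japanese x) a <= K) ->
  ray t <= d * (ray_speed t + 2 * lam) + 2 * Rpower lam (1 - p) * K * ray_speed t.
Proof.
  intros Ht Hlam HK.
  pose proof (data_rho D). pose proof (data_r D).
  assert (Hd : 0 < d <= rho) by (unfold d; lra).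
  set (c := r + 2 * t). set (V := ray_speed t).
  set (k := 2 * Rpower lam (1 - p) * K).
  assert (HK0 : 0 < K).
  { eapply Rlt_le_trans; [|apply (HK (r + t)); lra]. apply Rpower_pos. }
  assert (Hk : 0 < k).
  { unfold k. pose proof (Rpower_pos lam (1 - p)). apply Rmult_lt_0_compat; lra. }
  assert (HV : ut (c + -1 * t) t - -1 * ux (c + -1 * t) t = V).
  { unfold V, ray_speed, c. replace (r + 2 * t + -1 * t) with (r + 1 * t) by ring. ring. }
  assert (Q := flow_u_le W
    (fun s => (V + 2 * lam) * s + k * (along ut c (-1) s - -1 * along ux c (-1) s))
    (fun s => (V + 2 * lam) + k * source p a (c + -1 * s) (ux (c + -1 * s) s))
    (-1) c (t - d) t (or_intror eq_refl) ltac:(lra) ltac:(lra)).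
  cbv beta in Q. rewrite !(along_pos _ _ _ t), !(along_pos _ _ _ (t - d)), HV in Q by lra.
  rewrite (flow_outside (c + -1 * (t - d)) (t - d)) in Q.
  2: lra.
  2:{ unfold c, d. rewrite Rabs_pos_eq; lra. }
  assert (Hend : 0 <= ut (c + -1 * (t - d)) (t - d) - -1 * ux (c + -1 * (t - d)) (t - d)).
  { assert (P := flow_char_data (-1) (c + -1 * (t - d)) (t - d) (or_intror eq_refl) ltac:(lra)).
    destruct (data_out D (c + -1 * (t - d) - -1 * (t - d))) as (_ & E2 & E3).
    { unfold c. rewrite Rabs_pos_eq; lra. }
    rewrite E2, E3 in P. lra. }
  replace (u (c + -1 * t) t) with (ray t) in Q.
  2:{ unfold ray, c. f_equal. ring. }
  enough (ray t - 0 <= (V + 2 * lam) * t + k * V - ((V + 2 * lam) * (t - d) +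
    k * (ut (c + -1 * (t - d)) (t - d) - -1 * ux (c + -1 * (t - d)) (t - d)))) by (fold k; nra).
  apply Q.
  - intros s Hs. apply continuity_pt_plus.
    + apply derive_continuity_pt with (V + 2 * lam). auto_derive; [exact I | ring].
    + apply continuity_pt_scal. apply (flow_char_continuity W). lra.
  - intros s Hs. apply (is_derive_plus (fun s => (V + 2 * lam) * s)
      (fun s => k * (along ut c (-1) s - -1 * along ux c (-1) s))).
    + auto_derive; [exact I | ring].
    + apply (is_derive_scal (fun s => along ut c (-1) s - -1 * along ux c (-1) s) s k).
      apply (flow_char W); [auto | lra].
  - intros s Hs.
    assert (M := flow_char_mono W (-1) c s t (or_intror eq_refl) ltac:(lra) ltac:(lra)).
    rewrite HV in M.
    assert (Y := abs_le_source p a (c + -1 * s) (ux (c + -1 * s) s) lam K Hp Hlam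
      ltac:(apply HK; unfold c, d in *; lra)).
    assert (- ux (c + -1 * s) s <= Rabs (ux (c + -1 * s) s)).
    { rewrite <- Rabs_Ropp. apply Rle_abs. }
    unfold k. lra.
Qed.

(** The 6 is a bound for the ratio of [japanese x] to [S], and for its inverse,
    on the part of the support outside the ray at times between [S] and
    [2 S]. *)
Definition ray_const : R := 4 * Rpower (4 * ((rho - r) / 2)) (p - 1) * Rpower 6 (Rabs a).

(** [ray_le_young] with [lam = U / (4 d)].  The weight is replaced by a
    multiple of [S^a], for either sign of [a], because the support of the
    estimate lies at distance comparable to [S] from the origin. *)
Lemma ray_differential_ineq (S t : R) : 2 * rho <= S -> S <= t <= 2 * S -> t < T ->
  ray t <= ray_speed t * (2 * d + ray_const * Rpower S a * Rpower (ray t) (1 - p)).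
Proof.
  intros HS Ht HtT.
  pose proof (data_rho D). pose proof (data_r D).
  assert (Hd : 0 < d <= rho) by (unfold d; lra).
  assert (HU := ray_pos t ltac:(lra)).
  set (U := ray t) in *.
  assert (Y := ray_le_young t (U / (4 * d)) (Rpower 6 (Rabs a) * Rpower S a) ltac:(lra)
    ltac:(apply Rdiv_lt_0_compat; lra)).
  fold U in Y.
  replace (Rpower (U / (4 * d)) (1 - p)) with (Rpower U (1 - p) * Rpower (4 * d) (p - 1)) in Y.
  2:{ unfold Rdiv. rewrite <- (Rpower_mult_distr U (/ (4 * d))); [|exact HU|apply Rinv_0_lt_compat; lra].
      f_equal. unfold Rpower. rewrite ln_Rinv by lra. f_equal. ring. }
  replace (2 * (U / (4 * d))) with (U / (2 * d)) in Y by (field; lra).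
  assert (Y' : U <= d * (ray_speed t + U / (2 * d)) +
     2 * (Rpower U (1 - p) * Rpower (4 * d) (p - 1)) * (Rpower 6 (Rabs a) * Rpower S a) * ray_speed t).
  { apply Y. intros x Hx. apply Rpower_comparable; [lra | lra |].
    pose proof (japanese_ge_abs x). pose proof (japanese_le x).
    rewrite Rabs_pos_eq in * by lra. split; lra. }
  replace (d * (ray_speed t + U / (2 * d))) with (d * ray_speed t + U / 2) in Y' by (field; lra).
  unfold ray_const. fold d. lra.
Qed.

(** * The total mass, and its blow-up *)

Lemma space_continuous (h : R -> R -> R) (x t : R) : cont_strip T h -> 0 < t < T ->
  continuous (fun y => h y t) x.
Proof.
  intros H Ht. apply continuity_pt_filterlim. intros e He.
  destruct (cont_strip_interior T h x t H Ht (mkposreal e He)) as [del Hdel].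
  exists del. split; [apply cond_pos|]. intros y [_ Hy].
  apply (Hdel y t); [exact Hy|]. rewrite Rminus_diag, Rabs_R0. apply cond_pos.
Qed.

Lemma ex_RInt_slice (h : R -> R -> R) (x y t : R) : cont_strip T h -> 0 < t < T ->
  ex_RInt (fun z => h z t) x y.
Proof.
  intros H Ht. apply (ex_RInt_continuous (V := R_CompleteNormedModule)).
  intros z _. apply space_continuous; auto.
Qed.

Lemma slice_primitive (h : R -> R -> R) (x y t : R) : cont_strip T h -> 0 < t < T ->
  is_derive (fun z => RInt (fun z => h z t) x z) y (h y t).
Proof.
  intros H Ht. apply (is_derive_RInt (fun z => h z t) (fun z => RInt (fun z => h z t) x z) x y).
  - apply filter_forall. intros z. apply (RInt_correct (V := R_CompleteNormedModule)), ex_RInt_slice; auto.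
  - apply space_continuous; auto.
Qed.

Lemma slice_integral_derive (h ht : R -> R -> R) (x y t : R) :
  cont_strip T h -> cont_strip T ht ->
  (forall z s, 0 < s < T -> is_derive (fun r => h z r) s (ht z s)) -> 0 < t < T ->
  is_derive (fun s => RInt (fun z => h z s) x y) t (RInt (fun z => ht z t) x y).
Proof.
  intros Ch Cht Dh Ht.
  replace (RInt (fun z => ht z t) x y) with (RInt (fun z => Derive (fun s => h z s) t) x y).
  2:{ apply RInt_ext. intros z _. apply is_derive_unique, Dh, Ht. }
  apply (is_derive_RInt_param (fun s z => h z s) x y t).
  - apply filter_imp with (2 := locally_gt_lt t 0 T Ht). intros s Hs z _. eexists. apply Dh, Hs.
  - intros z _. apply continuity_2d_pt_ext_loc with (fun s z => ht z s).
    + destruct (locally_gt_lt t 0 T Ht) as [del Hdel]. exists del. intros s w Hs _.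
      symmetry. apply is_derive_unique, Dh, Hdel, Hs.
    + intros e. destruct (cont_strip_interior T ht z t Cht Ht e) as [del Hdel].
      exists del. intros s w Hs Hw. apply Hdel; assumption.
  - apply filter_imp with (2 := locally_gt_lt t 0 T Ht). intros s Hs. apply ex_RInt_slice; auto.
Qed.

Definition mass (h : R -> R -> R) (L t : R) : R := RInt (fun x => h x t) (- L) L.

(** Removes the boundary terms when [uxx] is integrated over the support. *)
Lemma slope_outside (x t : R) : 0 < t < T -> t + rho < Rabs x -> ux x t = 0.
Proof.
  intros Ht Hx.
  assert (E := is_derive_unique _ _ _ (flow_dx W x t ltac:(lra))).
  rewrite <- E. transitivity (Derive (fun _ => 0) x); [|apply Derive_const].
  apply Derive_ext_loc.
  assert (Near : forall y : R, Rabs (y - x) < Rabs x - (t + rho) -> u y t = 0).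
  { intros y Hy. apply flow_outside; [lra|].
    assert (Q := Rabs_triang_inv x (x - y)). replace (x - (x - y)) with y in Q by ring.
    rewrite Rabs_minus_sym in Hy. lra. }
  exists (mkposreal (Rabs x - (t + rho)) ltac:(lra)). exact Near.
Qed.

Lemma mass_nonneg (L t : R) : 0 < t < T -> 0 <= L -> 0 <= mass u L t.
Proof.
  intros Ht HL. apply RInt_ge_0; [lra| |].
  - apply ex_RInt_slice; [apply W | exact Ht].
  - intros x _. apply flow_nonneg. lra.
Qed.

(** By [flow_char_data] for both directions, [ut] is at least the space
    derivative of [w], which vanishes at both ends of the interval. *)
Lemma mass_speed_nonneg (L t : R) : 0 < t < T -> t + rho <= L -> 0 <= mass ut L t.
Proof.
  intros Ht HL. pose proof (data_rho D).
  set (w := fun x => eps / 2 * (f (x + t) - f (x - t))).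
  set (M := fun y => RInt (fun x => ut x t) (- L) y).
  assert (Dw : forall x, is_derive w x (eps / 2 * (df (x + t) - df (x - t)))).
  { intros x. pose proof (data_df D (x + t)) as H1.
    pose proof (data_df D (x - t)) as H2. unfold w.
    auto_derive.
    - repeat split; eexists; [apply H1 | apply H2].
    - replace (Derive (fun x0 => f x0) (x + t)) with (df (x + t)) by (symmetry; apply is_derive_unique, H1).
      replace (Derive (fun x0 => f x0) (x + - t)) with (df (x - t)) by (symmetry; apply is_derive_unique, H2).
      field. }
  assert (DM : forall x, is_derive M x (ut x t)).
  { intros x. apply slice_primitive; [apply W | exact Ht]. }
  assert (I : w L - w (- L) <= M L - M (- L)).
  { apply (increment_le w M (fun x => eps / 2 * (df (x + t) - df (x - t))) (fun x => ut x t)); auto; try lra.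
    - intros x _. eapply derive_continuity_pt, Dw.
    - intros x _. eapply derive_continuity_pt, DM.
    - intros x _.
      assert (P1 := flow_char_data 1 x t (or_introl eq_refl) ltac:(lra)).
      assert (P2 := flow_char_data (-1) x t (or_intror eq_refl) ltac:(lra)).
      replace (x - 1 * t) with (x - t) in P1 by ring.
      replace (x - -1 * t) with (x + t) in P2 by ring.
      pose proof (data_g D (x - t)). pose proof (data_g D (x + t)).
      assert (0 <= eps * g (x - t)) by (apply Rmult_le_pos; lra).
      assert (0 <= eps * g (x + t)) by (apply Rmult_le_pos; lra).
      lra. }
  assert (Z : forall x, rho <= Rabs x -> f x = 0) by (intros x Hx; apply (data_out D x Hx)).
  unfold w, M in I.
  rewrite (Z (L + t)), (Z (L - t)), (Z (- L + t)), (Z (- L - t)), RInt_point in I;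
    try (unfold Rabs; match goal with |- context [Rcase_abs ?e] => destruct (Rcase_abs e) end; lra).
  unfold mass. change (@zero _) with 0 in I. lra.
Qed.

(** Integrate [|ux| <= lam + const * source] in space from the left end.  The
    source equals [utt - uxx], so [N] is its primitive, and [N L] is the second
    time derivative of the mass because [ux] vanishes at both ends.  The weight
    is at most [2 L] since [a <= 1]. *)
Lemma flow_le_young (L lam x t : R) : 0 < t < T -> t + rho < L -> 0 < lam -> - L <= x <= L ->
  u x t <= 2 * L * (lam + Rpower lam (1 - p) * mass utt L t).
Proof.
  intros Ht HL Hlam Hx. pose proof (data_rho D).
  set (N := fun y => RInt (fun x => utt x t) (- L) y - ux y t).
  set (dN := fun y => source p a y (ux y t)).
  assert (DN : forall y, is_derive N y (dN y)).
  { intros y. unfold dN. rewrite <- (flow_eq W) by exact Ht.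
    apply (is_derive_minus (fun y => RInt (fun x => utt x t) (- L) y) (fun y => ux y t)).
    - apply slice_primitive; [apply W | exact Ht].
    - apply (flow_dxx W). lra. }
  assert (EL : N L = mass utt L t).
  { unfold N, mass. rewrite (slope_outside L t Ht); [apply Rminus_0_r|]. rewrite Rabs_pos_eq; lra. }
  assert (EmL : N (- L) = 0).
  { unfold N. rewrite (slope_outside (- L) t Ht), RInt_point; [apply Rminus_0_r|].
    rewrite Rabs_Ropp, Rabs_pos_eq; lra. }
  assert (HNx : N x <= N L).
  { apply (derive_nonneg_mono N dN); [lra| |]; intros y _; [apply DN | apply source_nonneg]. }
  set (k := Rpower lam (1 - p) * (2 * L)).
  assert (Hk : 0 < k) by (apply Rmult_lt_0_compat; [apply Rpower_pos | lra]).
  assert (Du : forall y, is_derive (fun y => u y t) y (ux y t)).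
  { intros y. apply (flow_dx W). lra. }
  assert (Dg : forall y, is_derive (fun y => lam * y + k * N y) y (lam + k * dN y)).
  { intros y. apply (is_derive_plus (fun y => lam * y) (fun y => k * N y)).
    - auto_derive; [exact I | ring].
    - apply (is_derive_scal N y k). apply DN. }
  assert (I : u x t - u (- L) t <= (lam * x + k * N x) - (lam * - L + k * N (- L))).
  { apply (increment_le (fun y => u y t) (fun y => lam * y + k * N y) (fun y => ux y t)
      (fun y => lam + k * dN y)); auto; try lra.
    - intros y _. eapply derive_continuity_pt, Du.
    - intros y _. eapply derive_continuity_pt, Dg.
    - intros y Hy. eapply Rle_trans; [apply Rle_abs|].
      apply abs_le_source; auto.
      apply Rle_trans with (Rpower (japanese y) 1).
      + apply Rle_Rpower; [apply japanese_ge_1 | exact Ha].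
      + pose proof (japanese_ge_1 y). rewrite Rpower_1 by lra.
        eapply Rle_trans; [apply japanese_le|].
        assert (Rabs y <= L) by (apply Rabs_le; lra). lra. }
  rewrite EmL, (flow_outside (- L) t) in I.
  2: lra.
  2:{ rewrite Rabs_Ropp, Rabs_pos_eq; lra. }
  rewrite EL in HNx. unfold k in *. nra.
Qed.

Lemma mass_le_young (L lam t : R) : 0 < t < T -> t + rho < L -> 0 < lam ->
  mass u L t <= 4 * L ^ 2 * (lam + Rpower lam (1 - p) * mass utt L t).
Proof.
  intros Ht HL Hlam. pose proof (data_rho D).
  apply Rle_trans with (RInt (fun _ => 2 * L * (lam + Rpower lam (1 - p) * mass utt L t)) (- L) L).
  - apply RInt_le; [lra| | |].
    + apply ex_RInt_slice; [apply W | exact Ht].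
    + apply ex_RInt_const.
    + intros x Hx. apply flow_le_young; auto. lra.
  - rewrite RInt_const. unfold scal; simpl; unfold mult; simpl. lra.
Qed.

(** The smallest [D] allowed in [no_global_superlinear] when
    [1 / k = (8 L^2)^p] with [L = 6 S]. *)
Definition barrier_height (S : R) : R :=
  Rpower (2 / (p - 1) * (2 / (p - 1) + 1) * Rpower (288 * S ^ 2) p) (1 / (p - 1)).

Definition ray_cap (S : R) : R := 24 * S * ((2 / (p - 1) + 2) * barrier_height S + 1).

(** If the ray value at [2 S] were at least the cap, it would stay so, and the
    second derivative of the mass would be at least [h] on a time interval of
    length 2.  The first half of it makes the mass and its derivative large
    enough for [no_global_superlinear] on the second half. *)
Lemma ray_lt_cap (S : R) : 2 * rho <= S -> 3 * S < T -> ray (2 * S) < ray_cap S.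
Proof.
  intros HS HT. pose proof (data_rho D).
  set (m := 2 / (p - 1)).
  assert (Hm : 0 < m) by (unfold m; apply Rdiv_lt_0_compat; lra).
  set (Q := Rpower (288 * S ^ 2) p). assert (HQ : 0 < Q) by apply Rpower_pos.
  set (B := barrier_height S). assert (HB : 0 < B) by apply Rpower_pos.
  assert (HBp : Rpower B (p - 1) = m * (m + 1) * Q).
  { unfold B, barrier_height. fold m. fold Q. rewrite Rpower_mult.
    replace (1 / (p - 1) * (p - 1)) with 1 by (field; lra). apply Rpower_1. nra. }
  destruct (Rlt_dec (ray (2 * S)) (ray_cap S)) as [Hlt|Hge]; [exact Hlt|exfalso].
  apply Rnot_lt_le in Hge. unfold ray_cap in Hge. fold m in Hge. fold B in Hge.
  set (L := 6 * S). set (h := (m + 2) * B + 1).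
  assert (Hh : 1 < h) by (unfold h; nra).
  assert (Acc : forall t, 2 * S <= t <= 2 * S + 2 -> h <= mass utt L t).
  { intros t Ht. assert (HU := ray_mono (2 * S) t ltac:(lra) ltac:(lra)).
    assert (HX : 24 * S * h <= ray t) by (unfold h; lra).
    apply Rle_trans with (Rpower (ray t / (2 * (2 * L))) p).
    - assert (Hz : h <= ray t / (2 * (2 * L))).
      { apply (Rmult_le_reg_l (24 * S)); [lra|].
        replace (24 * S * (ray t / (2 * (2 * L)))) with (ray t) by (unfold L; field; lra). exact HX. }
      apply Rle_trans with (Rpower (ray t / (2 * (2 * L))) 1).
      + rewrite Rpower_1; lra.
      + apply Rle_Rpower; lra.
    - apply young_optimize; [exact Hp | apply ray_pos; lra | unfold L; lra |].
      intros lam Hlam. unfold ray. pose proof (data_r D).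
      apply flow_le_young; auto; unfold L; lra. }
  assert (D1 : forall t, 2 * S <= t <= 2 * S + 2 -> is_derive (mass u L) t (mass ut L t)).
  { intros t Ht. apply slice_integral_derive; try apply W. lra. }
  assert (D2 : forall t, 2 * S <= t <= 2 * S + 2 -> is_derive (mass ut L) t (mass utt L t)).
  { intros t Ht. apply slice_integral_derive; try apply W. lra. }
  assert (Speed : forall t, 2 * S <= t <= 2 * S + 2 -> h * (t - 2 * S) <= mass ut L t).
  { intros t Ht.
    assert (P := mass_speed_nonneg L (2 * S) ltac:(lra) ltac:(unfold L; lra)).
    assert (I : h * t - h * (2 * S) <= mass ut L t - mass ut L (2 * S)); [|lra].
    apply (increment_le (fun s => h * s) (mass ut L) (fun _ => h) (mass utt L)); try lra.
    - intros s _. apply derive_continuity_pt with h. auto_derive; [exact I | ring].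
    - intros s Hs. eapply derive_continuity_pt. apply D2. lra.
    - intros s _. auto_derive; [exact I | ring].
    - intros s Hs. apply D2. lra.
    - intros s Hs. apply Acc. lra. }
  assert (Size : h / 2 <= mass u L (2 * S + 1)).
  { assert (P := mass_nonneg L (2 * S) ltac:(lra) ltac:(unfold L; lra)).
    assert (Dsq : forall s, is_derive (fun s => h / 2 * (s - 2 * S) ^ 2) s (h * (s - 2 * S))).
    { intros s. auto_derive; [exact I | field]. }
    assert (I : h / 2 * (2 * S + 1 - 2 * S) ^ 2 - h / 2 * (2 * S - 2 * S) ^ 2 <=
      mass u L (2 * S + 1) - mass u L (2 * S)); [|nra].
    apply (increment_le (fun s => h / 2 * (s - 2 * S) ^ 2) (mass u L) (fun s => h * (s - 2 * S)) (mass ut L)); try lra.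
    - intros s _. eapply derive_continuity_pt. apply Dsq.
    - intros s Hs. eapply derive_continuity_pt. apply D1. lra.
    - intros s _. apply Dsq.
    - intros s Hs. apply D1. lra.
    - intros s Hs. apply Speed. lra. }
  apply (no_global_superlinear p (/ Q) B (2 * S + 1) (mass u L) (mass ut L) (mass utt L)); auto.
  - apply Rinv_0_lt_compat, HQ.
  - fold m. rewrite HBp. right. field. lra.
  - intros t Ht. apply D1. lra.
  - intros t Ht. apply D2. lra.
  - intros t Ht HA.
    assert (Y : Rpower (mass u L t / (2 * (4 * L ^ 2))) p <= mass utt L t).
    { apply young_optimize; [exact Hp | exact HA | unfold L; nra |].
      intros lam Hlam. apply mass_le_young; auto; unfold L; lra. }
    replace (mass u L t / (2 * (4 * L ^ 2))) with (mass u L t * / (288 * S ^ 2)) in Y by (unfold L; field; lra).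
    rewrite <- (Rpower_mult_distr (mass u L t) (/ (288 * S ^ 2))) in Y;
      [|exact HA | apply Rinv_0_lt_compat; nra].
    replace (Rpower (/ (288 * S ^ 2)) p) with (/ Q) in Y; [lra|].
    unfold Q. rewrite <- Rpower_Ropp. unfold Rpower. rewrite ln_Rinv by nra. f_equal. ring.
  - unfold h in Size. nra.
  - fold m. specialize (Speed (2 * S + 1) ltac:(lra)). unfold h in Speed. nra.
Qed.

Lemma ray_bound_before_doubling (S : R) : 2 * rho <= S -> 3 * S < T ->
  ray_const * Rpower S a / (p - 1) * Rpower (ray S) (1 - p) <= S / 2 ->
  ray S * exp (S / (2 * (rho - r))) < ray_cap S.
Proof.
  intros HS HT Hsmall. pose proof (data_rho D). pose proof (data_r D).
  apply Rle_lt_trans with (2 := ray_lt_cap S HS HT).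
  apply (exponential_growth ray ray_speed p S (ray_const * Rpower S a)); try lra.
  - unfold ray_const. left. repeat apply Rmult_lt_0_compat; try apply Rpower_pos; lra.
  - intros t Ht. apply ray_pos. lra.
  - intros t Ht. apply ray_derive. lra.
  - intros t Ht. assert (E := ray_differential_ineq S t HS Ht ltac:(lra)).
    unfold d in E. replace (2 * ((rho - r) / 2)) with (rho - r) in E by field. exact E.
Qed.

(** For [a = 1] the inequality on the ray is applied at [S = t], where the
    weight is exactly [t]. *)
Lemma ray_logarithmic_escape (S c : R) : a = 1 -> 2 * rho <= S < T -> ray S <= c ->
  ln S - ln (2 * rho) <=
    ((rho - r) * Rpower c (p - 1) + ray_const) / (p - 1) * Rpower (eps * c0) (1 - p).
Proof.
  intros Ha1 HS Hc. pose proof (data_rho D). pose proof (data_r D).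
  pose proof (data_c0 D).
  assert (HB : 0 < ray_const).
  { unfold ray_const. repeat apply Rmult_lt_0_compat; try apply Rpower_pos; lra. }
  eapply Rle_trans.
  - apply (logarithmic_escape ray ray_speed p (2 * rho) S ray_const (rho - r) c); try lra.
    + intros t Ht. split; [apply ray_pos; lra|]. apply Rle_trans with (2 := Hc). apply ray_mono; lra.
    + intros t Ht. apply ray_speed_nonneg. lra.
    + intros t Ht. apply ray_derive. lra.
    + intros t Ht. assert (E := ray_differential_ineq t t ltac:(lra) ltac:(lra) ltac:(lra)).
      unfold d in E. replace (2 * ((rho - r) / 2)) with (rho - r) in E by field.
      replace (Rpower t a) with t in E by (rewrite Ha1, Rpower_1; lra). exact E.
  - apply Rmult_le_compat_l.
    + left. apply Rdiv_lt_0_compat; [|lra]. pose proof (Rpower_pos c (p - 1)). nra.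
    + apply Rpower_antitone; [apply Rmult_lt_0_compat; lra | apply ray_lower; lra | lra].
Qed.
End Bump.

(** * Choice of the constants *)

Lemma ray_const_pos (p a rho r : R) : 0 < ray_const p a rho r.
Proof. unfold ray_const. repeat apply Rmult_lt_0_compat; try apply Rpower_pos; lra. Qed.

(** The value of [threshold] at [S = 1], and at every [S] when [a = 1].  The
    threshold itself is the [X] for which [threshold_suffices] is an
    equality. *)
Definition critical_size (p a rho r : R) : R :=
  Rpower (2 * ray_const p a rho r / (p - 1)) (1 / (p - 1)).

Definition threshold (p a rho r S : R) : R :=
  critical_size p a rho r * Rpower S ((a - 1) / (p - 1)).

Lemma threshold_suffices (p a rho r S X : R) : 1 < p -> 0 < S -> threshold p a rho r S <= X ->
  ray_const p a rho r * Rpower S a / (p - 1) * Rpower X (1 - p) <= S / 2.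
Proof.
  intros Hp HS HX. pose proof (ray_const_pos p a rho r) as HB.
  unfold threshold, critical_size in HX.
  set (B := ray_const p a rho r) in *.
  assert (HBp : 0 < 2 * B / (p - 1)) by (apply Rdiv_lt_0_compat; lra).
  assert (E : Rpower X (1 - p) <= / (2 * B / (p - 1)) * Rpower S (1 - a)).
  { eapply Rle_trans; [eapply Rpower_antitone; [|exact HX|lra]|].
    - apply Rmult_lt_0_compat; apply Rpower_pos.
    - rewrite <- Rpower_mult_distr, !Rpower_mult by apply Rpower_pos.
      replace (1 / (p - 1) * (1 - p)) with (- (1)) by (field; lra).
      replace ((a - 1) / (p - 1) * (1 - p)) with (1 - a) by (field; lra).
      rewrite Rpower_Ropp, Rpower_1 by exact HBp. lra. }
  pose proof (Rpower_pos S a) as HSa.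
  apply Rle_trans with (B * Rpower S a / (p - 1) * (/ (2 * B / (p - 1)) * Rpower S (1 - a))).
  - apply Rmult_le_compat_l; [|exact E]. left. apply Rdiv_lt_0_compat; [nra | lra].
  - right. replace (B * Rpower S a / (p - 1) * (/ (2 * B / (p - 1)) * Rpower S (1 - a)))
      with (/ 2 * (Rpower S a * Rpower S (1 - a))) by (field; lra).
    rewrite <- Rpower_plus. replace (a + (1 - a)) with 1 by ring. rewrite Rpower_1 by exact HS. field.
Qed.

(** The cap is at most a power of [S] and the threshold is one, so the
    exponential factor wins. *)
Lemma cap_le_threshold_exp (p a rho r : R) : 1 < p -> r < rho ->
  exists S0, 1 <= S0 /\ forall S, S0 <= S ->
    ray_cap p S <= threshold p a rho r S * exp (S / (2 * (rho - r))).
Proof.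
  intros Hp Hr. set (m := 2 / (p - 1)).
  assert (Hm : 0 < m) by (unfold m; apply Rdiv_lt_0_compat; lra).
  assert (Hc : 0 < critical_size p a rho r) by apply Rpower_pos.
  set (c := critical_size p a rho r) in *.
  set (K1 := Rpower (m * (m + 1) * Rpower 288 p) (1 / (p - 1))).
  assert (HK1 : 0 < K1) by apply Rpower_pos.
  set (K := 24 * ((m + 2) * K1 + 1) / c).
  set (N := 1 + 2 * p / (p - 1) - (a - 1) / (p - 1)).
  destruct (polynomial_le_exponential K N (/ (2 * (rho - r)))) as (S0 & HS0 & H).
  { apply Rdiv_lt_0_compat; nra. }
  { apply Rinv_0_lt_compat. lra. }
  exists S0. split; [exact HS0|]. intros S HS. specialize (H S HS).
  unfold threshold. fold c.
  replace (/ (2 * (rho - r)) * S) with (S / (2 * (rho - r))) in H by (field; lra).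
  assert (HD : barrier_height p S = K1 * Rpower S (2 * p / (p - 1))).
  { unfold barrier_height, K1. fold m.
    pose proof (Rpower_pos 288 p). pose proof (Rpower_pos S (2 * p)).
    rewrite <- (Rpower_mult_distr 288 (S ^ 2)) by nra.
    rewrite <- (Rpower_pow 2 S) by lra. rewrite (Rpower_mult S). simpl INR.
    replace ((1 + 1) * p) with (2 * p) by ring.
    assert (0 < m * (m + 1) * Rpower 288 p) by (apply Rmult_lt_0_compat; nra).
    rewrite <- Rmult_assoc, <- (Rpower_mult_distr _ (Rpower S (2 * p))) by assumption.
    rewrite (Rpower_mult S).
    f_equal. f_equal. field. lra. }
  assert (HS1 : 1 <= Rpower S (2 * p / (p - 1))).
  { apply Rle_trans with (Rpower S 0); [rewrite Rpower_O; lra|].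
    apply Rle_Rpower; [lra|]. left. apply Rdiv_lt_0_compat; lra. }
  apply Rle_trans with (24 * ((m + 2) * K1 + 1) * (S * Rpower S (2 * p / (p - 1)))).
  - unfold ray_cap. fold m. rewrite HD.
    replace (24 * ((m + 2) * K1 + 1) * (S * Rpower S (2 * p / (p - 1))))
      with (24 * S * (((m + 2) * K1 + 1) * Rpower S (2 * p / (p - 1)))) by ring.
    apply Rmult_le_compat_l; [lra|]. nra.
  - assert (E : S * Rpower S (2 * p / (p - 1)) = Rpower S ((a - 1) / (p - 1)) * Rpower S N).
    { rewrite <- (Rpower_1 S) at 1 by lra. rewrite <- !Rpower_plus. f_equal. unfold N. ring. }
    rewrite E.
    replace (24 * ((m + 2) * K1 + 1) * (Rpower S ((a - 1) / (p - 1)) * Rpower S N))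
      with (c * Rpower S ((a - 1) / (p - 1)) * (K * Rpower S N)) by (unfold K; field; lra).
    apply Rmult_le_compat_l; [|exact H].
    left. apply Rmult_lt_0_compat; [exact Hc | apply Rpower_pos].
Qed.

Definition escape_const (p a rho r : R) : R :=
  ((rho - r) * Rpower (critical_size p a rho r) (p - 1) + ray_const p a rho r) / (p - 1).

(** A ray value above the threshold at time [S] grows exponentially until
    [2 S] and violates the cap.  For [a = 1], being below the threshold at [S]
    bounds [ln S] by a multiple of [eps^(1-p)]. *)
Lemma solution_below_threshold (p a rho r c0 : R) (f df g G : R -> R) :
  1 < p -> a <= 1 -> bump_data rho r c0 f df g G ->
  exists S0, 1 <= S0 /\ forall eps T u S, 0 < eps ->
    classical_solution p a (fun x => eps * f x) (fun x => eps * g x) T u ->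
    S0 <= S -> 3 * S < T ->
    eps * c0 < threshold p a rho r S /\
    (a = 1 -> ln S - ln (2 * rho) <= escape_const p a rho r * Rpower (eps * c0) (1 - p)).
Proof.
  intros Hp Ha D. pose proof (data_rho D). pose proof (data_r D).
  destruct (cap_le_threshold_exp p a rho r Hp ltac:(lra)) as (S1 & HS1 & Hcap).
  exists (Rmax S1 (2 * rho)). pose proof (Rmax_l S1 (2 * rho)). pose proof (Rmax_r S1 (2 * rho)).
  split; [lra|]. intros eps T u S Heps Hsol HS HT.
  destruct (classical_solution_flow p a T _ _ u ltac:(lra) Hsol)
    as (ux & ut & uxx & utt & W & I0 & I1' & I2).
  assert (I1 : forall x, ux x 0 = eps * df x).
  { intros x. assert (E1 := is_derive_unique _ _ _ (I1' x)).
    assert (E2 := is_derive_unique _ _ _ (is_derive_scal f x eps (df x) (data_df D x))).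
    rewrite <- E1. exact E2. }
  assert (Hlow := ray_lower p a T u ux ut uxx utt W rho r c0 f df g G D eps Heps I0 I1 I2 S ltac:(lra)).
  assert (Hlt : ray u r S < threshold p a rho r S).
  { destruct (Rlt_dec (ray u r S) (threshold p a rho r S)) as [L|L]; [exact L|exfalso].
    apply Rnot_lt_le in L.
    assert (Q := ray_bound_before_doubling p a T u ux ut uxx utt W rho r c0 f df g G D eps
      Hp Ha Heps I0 I1 I2 S ltac:(lra) HT (threshold_suffices p a rho r S _ Hp ltac:(lra) L)).
    specialize (Hcap S ltac:(lra)).
    pose proof (exp_pos (S / (2 * (rho - r)))). nra. }
  split; [lra|]. intros Ha1.
  apply (ray_logarithmic_escape p a T u ux ut uxx utt W rho r c0 f df g G D eps
      Hp Heps I0 I1 I2 S (critical_size p a rho r) Ha1 ltac:(lra)).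
  unfold threshold in Hlt. rewrite Ha1 in Hlt at 2.
  replace ((1 - 1) / (p - 1)) with 0 in Hlt by (field; lra).
  rewrite Rpower_O in Hlt by lra. lra.
Qed.

Lemma supp_contains (f : R -> R) (x : R) : f x <> 0 -> supp f x.
Proof.
  intros H V HV. exists x. split; [|exact H].
  destruct HV as [d Hd]. apply Hd. unfold disc. rewrite Rminus_diag, Rabs_R0. apply cond_pos.
Qed.

Lemma zero_outside (f : R -> R) (R0 x : R) : included (supp f) (fun x => Rabs x <= R0) ->
  R0 < Rabs x -> f x = 0.
Proof.
  intros Hs Hx. destruct (Req_dec (f x) 0) as [E|E]; [exact E|exfalso].
  assert (Rabs x <= R0) by (apply (Hs x), supp_contains, E). lra.
Qed.

Lemma bump_data_exists (R0 : R) (f g : R -> R) : 1 <= R0 -> C0k 2 f -> C0k 1 g ->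
  included (supp f) (fun x => Rabs x <= R0) -> included (supp g) (fun x => Rabs x <= R0) ->
  (forall x, 0 <= f x) -> (forall x, 0 <= g x) ->
  (exists x, f x <> 0) \/ (exists x, g x <> 0) ->
  exists rho r c0 df G, bump_data rho r c0 f df g G.
Proof.
  intros HR0 [Cf _] [Cg _] Sf Sg Pf Pg Hne.
  set (rho := R0 + 1). set (G := fun x => RInt g 0 x).
  assert (contg : forall x, continuous g x).
  { intros x. apply (Cg 0%nat x). auto. }
  assert (DG : forall x, is_derive G x (g x)).
  { intros x. apply (is_derive_RInt g G 0 x); [|apply contg].
    apply filter_forall. intros y. apply (RInt_correct (V := R_CompleteNormedModule)).
    apply (ex_RInt_continuous (V := R_CompleteNormedModule)). intros z _. apply contg. }
  assert (Df : forall x, is_derive f x (Derive f x)).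
  { intros x. apply Derive_correct. apply (Cf 1%nat x). auto. }
  assert (Gmono : forall x y, x <= y -> G x <= G y).
  { intros x y Hxy. apply (derive_nonneg_mono G g); auto. }
  assert (Out : forall x, rho <= Rabs x -> f x = 0 /\ Derive f x = 0 /\ g x = 0).
  { intros x Hx. assert (HRx : R0 < Rabs x) by (unfold rho in Hx; lra).
    split; [apply (zero_outside f R0); auto|]. split; [|apply (zero_outside g R0); auto].
    transitivity (Derive (fun _ => 0) x); [|apply Derive_const]. apply Derive_ext_loc.
    assert (Near : forall y : R, Rabs (y - x) < Rabs x - R0 -> f y = 0).
    { intros y Hy. apply (zero_outside f R0); auto.
      assert (Q := Rabs_triang_inv x (x - y)). replace (x - (x - y)) with y in Q by ring.
      rewrite Rabs_minus_sym in Hy. lra. }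
    exists (mkposreal (Rabs x - R0) ltac:(lra)). exact Near. }
  assert (Pick : exists r, - rho <= r < rho /\ 0 < f r + (G rho - G r)).
  { destruct Hne as [[x Hx] | [x Hx]].
    - exists x.
      assert (Rabs x <= R0).
      { apply Rnot_lt_le. intros L. apply Hx, (zero_outside f R0); auto. }
      assert (- R0 <= x <= R0) by (apply Rabs_le_between; assumption).
      specialize (Pf x). specialize (Gmono x rho ltac:(unfold rho; lra)).
      unfold rho in *. split; lra.
    (* with [r = - rho] the free wave sees the whole of [g] *)
    - exists (- rho).
      assert (Rabs x <= R0).
      { apply Rnot_lt_le. intros L. apply Hx, (zero_outside g R0); auto. }
      assert (Hxb : - R0 <= x <= R0) by (apply Rabs_le_between; assumption).
      split; [unfold rho; lra|]. specialize (Pf (- rho)).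
      enough (G (- rho) < G rho) by lra.
      destruct (Rlt_dec (G (- rho)) (G rho)) as [L|L]; [exact L|exfalso]. apply Hx.
      rewrite <- (is_derive_unique _ _ _ (DG x)).
      transitivity (Derive (fun _ => G rho) x); [|apply Derive_const]. apply Derive_ext_loc.
      apply filter_imp with (2 := locally_gt_lt x (- rho) rho ltac:(unfold rho; lra)).
      intros y Hy. apply Rle_antisym; [apply Gmono; lra|].
      apply Rle_trans with (G (- rho)); [lra | apply Gmono; lra]. }
  destruct Pick as (r & Hr & Hpos).
  exists rho, r, ((f r + (G rho - G r)) / 2), (Derive f), G.
  constructor; auto; try lra. unfold rho; lra.
Qed.

(** [C] is chosen so that at [S = C eps^(-(p-1)/(1-a))] the threshold equals
    [eps c0], the lower bound for the ray; [eps1] makes [S] at least [S0]. *)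
Lemma lifespan_subcritical (p a rho r c0 : R) (f df g G : R -> R) :
  1 < p -> a < 1 -> bump_data rho r c0 f df g G ->
  exists eps1 C, 0 < eps1 /\ 0 < C /\ forall eps, 0 < eps <= eps1 ->
    forall T, C * Rpower eps (- (p - 1) / (1 - a)) < T ->
    forall u, ~ classical_solution p a (fun x => eps * f x) (fun x => eps * g x) T u.
Proof.
  intros Hp Ha D. destruct (data_c0 D) as [Hc0 _].
  destruct (solution_below_threshold p a rho r c0 f df g G Hp ltac:(lra) D) as (S0 & HS0 & H).
  assert (Hc : 0 < critical_size p a rho r) by apply Rpower_pos.
  set (c := critical_size p a rho r) in *.
  set (q := (p - 1) / (1 - a)). assert (Hq : 0 < q) by (apply Rdiv_lt_0_compat; lra).
  set (C := Rpower (c / c0) q). assert (HC : 0 < C) by apply Rpower_pos.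
  exists (Rpower (S0 / C) (- / q)), (3 * C).
  split; [apply Rpower_pos|]. split; [lra|]. intros eps [He He1] T HT u Hsol.
  replace (- (p - 1) / (1 - a)) with (- q) in HT by (unfold q; field; lra).
  set (S := C * Rpower eps (- q)).
  assert (HSS : S0 <= S).
  { assert (E : Rpower (Rpower (S0 / C) (- / q)) (- q) <= Rpower eps (- q)) by (apply Rpower_antitone; lra).
    rewrite Rpower_mult in E. replace (- / q * - q) with 1 in E by (field; lra).
    rewrite Rpower_1 in E by (apply Rdiv_lt_0_compat; lra).
    unfold S. apply (Rmult_le_compat_l C) in E; [|lra].
    replace (C * (S0 / C)) with S0 in E by (field; lra). exact E. }
  destruct (H eps T u S He Hsol HSS ltac:(unfold S; lra)) as [Hlt _].
  unfold threshold in Hlt. fold c in Hlt.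
  replace ((a - 1) / (p - 1)) with (- / q) in Hlt by (unfold q; field; lra).
  unfold S, C in Hlt. rewrite <- Rpower_mult_distr, !Rpower_mult in Hlt by apply Rpower_pos.
  replace (- q * - / q) with 1 in Hlt by (field; lra).
  replace (q * - / q) with (- (1)) in Hlt by (field; lra).
  rewrite Rpower_Ropp, !Rpower_1 in Hlt; [|exact He | apply Rdiv_lt_0_compat; lra].
  replace (c * (/ (c / c0) * eps)) with (eps * c0) in Hlt by (field; lra). lra.
Qed.

(** Let [w = eps^(-(p-1))], which is at least 1.  At [S = exp (C1 w)] the
    bound on [ln S] of [solution_below_threshold], a multiple of [w] plus a
    constant, fails as soon as [C1] exceeds the sum of the two.  The extra 2 in
    the final constant accounts for the factor 3 in [3 S < T]. *)
Lemma lifespan_critical (p rho r c0 : R) (f df g G : R -> R) :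
  1 < p -> bump_data rho r c0 f df g G ->
  exists eps1 C, 0 < eps1 /\ 0 < C /\ forall eps, 0 < eps <= eps1 ->
    forall T, exp (C * Rpower eps (- (p - 1))) < T ->
    forall u, ~ classical_solution p 1 (fun x => eps * f x) (fun x => eps * g x) T u.
Proof.
  intros Hp D. destruct (data_c0 D) as [Hc0 _]. pose proof (data_rho D).
  destruct (solution_below_threshold p 1 rho r c0 f df g G Hp ltac:(lra) D) as (S0 & HS0 & H1).
  set (E := escape_const p 1 rho r * Rpower c0 (1 - p)) in *.
  set (l := ln (2 * rho)).
  assert (Hl : 0 <= l) by (unfold l; rewrite <- ln_1; left; apply ln_increasing; lra).
  set (C1 := Rabs E + l + S0).
  pose proof (Rabs_pos E). pose proof (Rle_abs E).
  exists 1, (C1 + 2). split; [lra|]. split; [unfold C1; lra|].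
  intros eps [He He1] T HT u Hsol.
  set (w := Rpower eps (- (p - 1))) in *.
  assert (Hw : 1 <= w).
  { apply Rle_trans with (Rpower 1 (- (p - 1))).
    - unfold Rpower. rewrite ln_1, Rmult_0_r, exp_0. lra.
    - apply Rpower_antitone; lra. }
  set (S := exp (C1 * w)).
  assert (HC1 : S0 <= C1) by (unfold C1; lra).
  assert (HS : S0 <= S).
  { pose proof (exp_ineq1 (C1 * w) ltac:(nra)). unfold S. nra. }
  assert (H3 : 3 * S < T).
  { eapply Rle_lt_trans; [|exact HT].
    replace ((C1 + 2) * w) with (2 * w + C1 * w) by ring. rewrite exp_plus.
    apply Rmult_le_compat_r; [left; apply exp_pos|].
    pose proof (exp_ineq1 (2 * w) ltac:(lra)). lra. }
  destruct (H1 eps T u S He Hsol HS H3) as [_ Hln]. specialize (Hln eq_refl).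
  unfold S in Hln. rewrite ln_exp in Hln. fold l in Hln.
  rewrite <- Rpower_mult_distr in Hln by assumption.
  replace (1 - p) with (- (p - 1)) in Hln at 1 by ring. fold w in Hln.
  replace (escape_const p 1 rho r * (w * Rpower c0 (1 - p))) with (E * w) in Hln by (unfold E; ring).
  unfold C1 in Hln. nra.
Qed.

Theorem theorem2p1 (p a R0 : R) (f g : R -> R)
  (hp : 1 < p) (ha : a <= 1) (hR0 : 1 <= R0)
  (hf : C0k 2 f) (hg : C0k 1 g)
  (hsf : included (supp f) (fun x => Rabs x <= R0))
  (hsg : included (supp g) (fun x => Rabs x <= R0))
  (hpos :
    ((forall x, 0 <= f x) /\ (forall x, 0 <= g x) /\ ~ (forall x, f x = 0)) \/
    ((forall x, 0 <= f x) /\ (forall x, 0 <= g x) /\ ~ (forall x, g x = 0))) :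
  exists eps1 C : R, 0 < eps1 /\ 0 < C /\
    forall eps : R, 0 < eps <= eps1 ->
    forall T : R,
      (if Rlt_dec a 1 then C * Rpower eps (- (p - 1) / (1 - a))
       else exp (C * Rpower eps (- (p - 1)))) < T ->
      ~ exists u : R -> R -> R,
          classical_solution p a (fun x => eps * f x) (fun x => eps * g x) T u.
Proof.
  assert (Hdata : exists rho r c0 df G, bump_data rho r c0 f df g G).
  { apply (bump_data_exists R0); auto; try tauto.
    destruct hpos as [(_ & _ & H) | (_ & _ & H)]; [left | right]; apply not_all_ex_not, H. }
  destruct Hdata as (rho & r & c0 & df & G & D).
  destruct (Rlt_dec a 1) as [Ha|Ha].
  - destruct (lifespan_subcritical p a rho r c0 f df g G hp Ha D) as (eps1 & C & He & HC & H).
    exists eps1, C. split; [exact He|]. split; [exact HC|].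
    intros eps Heps T HT [u Hu]. exact (H eps Heps T HT u Hu).
  - assert (a = 1) by lra. subst a.
    destruct (lifespan_critical p rho r c0 f df g G hp D) as (eps1 & C & He & HC & H).
    exists eps1, C. split; [exact He|]. split; [exact HC|].
    intros eps Heps T HT [u Hu]. exact (H eps Heps T HT u Hu).
Qed.
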